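(* There is an absolute constant $C>0$ such that the following holds. Let $N\in\mathbb{N}$ and $\delta\in\mathbb{R}$ satisfy $\delta>\sqrt{(1+\log N)/N}$. Then $$M(N^2)=\sum_{\substack{j\in\mathbb{N}\\ |\nu_{j-}|>\delta}}\left(\sum_{n=1}^N\mu(n)\phi_{j-}\!\left(\tfrac nN\right)\right)^{2}|\nu_{j-}| \;-\sum_{\substack{j\in\mathbb{N}\\ \nu_{j+}>\delta}}\left(\sum_{n=1}^N\mu(n)\phi_{j+}\!\left(\tfrac nN\right)\right)^{2}\nu_{j+} + \frac{(M(N))^2}{2}-\left(\sum_{n=1}^N\frac{\mu(n)}{n}\right)^{2}N^2+E,$$ where $|E|\le C\delta N^2$.
   Context: $\mu$ is the Möbius function and $M(x)=\sum_{n\le x}\mu(n)$. Let $K(x,y)=\tfrac12-\{1/(xy)\}$ for $0<x,y\le1$ and $K(x,0)=K(0,x)=0$, where $\{\cdot\}$ is the fractional part; $K$ is a real symmetric kernel with $\int_0^1\int_0^1K^2<\infty$. A number $\lambda$ is an eigenvalue of $K$ if there is a measurable $\phi$ with $0<\int_0^1|\phi|^2<\infty$ and $\phi(x)=\lambda\int_0^1K(x,y)\phi(y)dy$ for all $x\in[0,1]$; the index of $\lambda$ is the (finite) dimension of the space spanned by such $\phi$. List the positive eigenvalues as $\lambda_{1+}\le\lambda_{2+}\le\cdots$ ($k\le p$) and the negative ones as $\lambda_{1-}\ge\lambda_{2-}\ge\cdots$ ($k\le q$), each repeated according to its index; set $\nu_{k\pm}=1/\lambda_{k\pm}$ when defined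 and $\nu_{k\pm}=0$ otherwise. The functions $\phi_{k+}$ ($k\le p$) and $\phi_{k-}$ ($k\le q$) are real eigenfunctions with $\nu_{k\pm}\phi_{k\pm}(x)=\int_0^1K(x,y)\phi_{k\pm}(y)dy$ for all $x\in[0,1]$, chosen so that the whole family $\{\phi_{k+}\}\cup\{\phi_{k-}\}$ is orthonormal with respect to $\langle\alpha,\beta\rangle=\int_0^1\alpha\beta$. *)

(* Defs.v *)
From HB Require Import structures.
From mathcomp Require Import all_boot all_order all_algebra.
From mathcomp Require Import all_classical all_reals all_analysis.

Set Implicit Arguments.
Unset Strict Implicit.
Unset Printing Implicit Defensive.

Import Order.TTheory GRing.Theory Num.Theory.
Import numFieldNormedType.Exports.

Local Open Scope classical_set_scope.
Local Open Scope ring_scope.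

Definition squarefree (n : nat) : bool :=
  (0 < n)%N && all (fun p => logn p n == 1%N) (primes n).

Definition mobius (n : nat) : int :=
  if squarefree n then (-1) ^+ size (primes n) else 0.

Definition mertens {R : realType} (x : R) : int :=
  \sum_(1 <= n < (Num.truncn x).+1) mobius n.

Definition frac {R : realType} (x : R) : R := x - (Num.floor x)%:~R.

(* Only used for x and y in [0, 1]. *)
Definition kerK {R : realType} (x y : R) : R :=
  if (0 < x) && (0 < y) then 2^-1 - frac (1 / (x * y)) else 0.

Section Eigen.
Context {R : realType}.
Implicit Types (l : R) (phi : R -> R).

Definition I01 : set R := `[0, 1]%classic.

Local Notation mu := (@lebesgue_measure R).

(* K is real and l is real, so real-valued functions suffice: the real and
   imaginary parts of a complex-valued solution are solutions. *)
Definition eigenfunction l phi : Prop :=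
  [/\ measurable_fun I01 phi,
      (0 < \int[mu]_(x in I01) (`|phi x| ^+ 2)%:E < +oo)%E
    & forall x, 0 <= x <= 1 ->
        phi x = l * \int[mu]_(y in I01) (kerK x y * phi y)].

Definition eigenvalue l : Prop := exists phi, eigenfunction l phi.

(* The space spanned by the eigenfunctions of l has dimension d: d of them form
   a basis of it. Only restrictions to [0, 1] count in linear relations. *)
Definition has_index l (d : nat) : Prop :=
  exists e : 'I_d -> R -> R,
    [/\ forall i, eigenfunction l (e i),
        forall c : 'I_d -> R,
          (forall x, 0 <= x <= 1 -> \sum_(i < d) c i * e i x = 0) ->
          forall i, c i = 0
      & forall phi, eigenfunction l phi ->
          exists c : 'I_d -> R,
            forall x, 0 <= x <= 1 -> phi x = \sum_(i < d) c i * e i x].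

(* Families have a length in nat + {oo}, with None for oo, and are indexed
   from 0: the k-th term of a list starting at 1 has index k - 1 here. *)
Definition in_range (p : option nat) (k : nat) : bool :=
  if p is Some m then (k < m)%N else true.

Definition lists_eigenvalues (D : pred R) (before : rel R)
    (p : option nat) (lam : nat -> R) : Prop :=
  [/\ forall k, in_range p k -> D (lam k) /\ eigenvalue (lam k),
      forall j k, (j <= k)%N -> in_range p k -> before (lam j) (lam k)
    & forall l, D l -> exists2 d, has_index l d &
        ([set k | in_range p k /\ lam k = l] #= `I_d)%card].

Definition lists_positive_eigenvalues :=
  lists_eigenvalues (fun l => 0 < l) (fun a b => a <= b).

Definition lists_negative_eigenvalues :=
  lists_eigenvalues (fun l => l < 0) (fun a b => b <= a).

Definition nu (p : option nat) (lam : nat -> R) (k : nat) : R :=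
  if in_range p k then (lam k)^-1 else 0.

Definition eigenfunctions_of (p : option nat) (lam : nat -> R)
    (phi : nat -> R -> R) : Prop :=
  forall k, in_range p k ->
    eigenfunction (lam k) (phi k) /\
    forall x, 0 <= x <= 1 ->
      nu p lam k * phi k x = \int[mu]_(y in I01) (kerK x y * phi k y).

Definition inner (f g : R -> R) : R :=
  \int[mu]_(x in I01) (f x * g x).

Definition orthonormal2 (p q : option nat) (phip phim : nat -> R -> R) : Prop :=
  [/\ forall j k, in_range p j -> in_range p k ->
        inner (phip j) (phip k) = (j == k)%:R,
      forall j k, in_range q j -> in_range q k ->
        inner (phim j) (phim k) = (j == k)%:R
    & forall j k, in_range p j -> in_range q k ->
        inner (phip j) (phim k) = 0].

End Eigen.

(* Main.v *)
Require Import Defs.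
From HB Require Import structures.
From mathcomp Require Import all_boot all_order all_algebra.
From mathcomp Require Import all_classical all_reals all_analysis.
From mathcomp Require Import measurable_realfun.
From mathcomp Require Import ring lra zify.
Import Order.TTheory GRing.Theory Num.Theory.
Import numFieldNormedType.Exports.

(* By the identity M(N^2) = 2 M(N) - sum mu(m) mu(n) floor(N^2/(mn)) (m, n <= N)
   everything reduces to the form Q = sum mu(m) mu(n) K(m/N, n/N). Let alpha be
   the step function with value mu(n) on ](n-1)/N, n/N] and T the operator with
   kernel K. Bounding the oscillation of K on the cells shows that
   F = sum mu(n) K(n/N, .) differs from N T alpha by O(sqrt (N (1 + log N))) in
   L^2, which is O(delta N). As nu_j phi_j = T phi_j, Bessel's inequality then
   lets us replace the samples sum mu(n) phi_j(n/N) by N <alpha, phi_j>, and Q by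
   N^2 <alpha, T alpha>, at a cost O(delta N^2). What remains is the quadratic
   form of S = T - sum_{|nu_j| > delta} nu_j phi_j (x) phi_j. If it exceeded
   delta |alpha|^2, then S would have an eigenvalue of modulus > delta whose
   eigenfunction is an eigenfunction of T orthogonal to all listed ones,
   contradicting the completeness of the lists.

   The existence of this eigenvalue is obtained by Schmidt's method: the
   Hilbert-Schmidt norms of the iterated kernels S_n satisfy
   |S_{2n}| <= |S_n|^2, so that after division by rho^n, rho being their growth
   rate, they stay >= 1 and converge; the normalised even iterates are then
   uniformly Cauchy, and a column of their limit is an eigenfunction of S^2. *)

Set Implicit Arguments.
Unset Strict Implicit.
Unset Printing Implicit Defensive.
Local Open Scope classical_set_scope.
Local Open Scope ring_scope.

(** * Bounded measurable functions on a probability space *)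

Section BoundedMeasurable.
Context d (T : measurableType d) (R : realType).
Implicit Types f g : T -> R.

(** Boundedness is asked at every point, not almost everywhere: sums, products, slices and kernel
    integrals stay in the class without exceptional sets, and its members are integrable over a set
    of measure 1. *)
Definition bdm f := measurable_fun setT f /\ exists B : R, forall x, `|f x| <= B.

Lemma bdm_ext f g : f =1 g -> bdm f -> bdm g.
Proof. by move=> /funext ->. Qed.

Lemma bdm_cst c : bdm (fun=> c).
Proof. by split; [exact: measurable_cst|exists `|c|]. Qed.

Lemma bdmD f g : bdm f -> bdm g -> bdm (fun x => f x + g x).
Proof.
move=> [mf [A fA]] [mg [B gB]]; split; first exact: measurable_funD.
by exists (A + B) => x; rewrite (le_trans (ler_normD _ _))// lerD.
Qed.

Lemma bdmM f g : bdm f -> bdm g -> bdm (fun x => f x * g x).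
Proof.
move=> [mf [A fA]] [mg [B gB]]; split; first exact: measurable_funM.
by exists (A * B) => x; rewrite normrM ler_pM.
Qed.

Lemma bdmZ c f : bdm f -> bdm (fun x => c * f x).
Proof. exact: bdmM (bdm_cst c). Qed.

Lemma bdmN f : bdm f -> bdm (fun x => - f x).
Proof. by move/(bdmZ (-1)); apply: bdm_ext => x; rewrite mulN1r. Qed.

Lemma bdmB f g : bdm f -> bdm g -> bdm (fun x => f x - g x).
Proof. by move=> bf /bdmN; exact: bdmD. Qed.

Lemma bdm_norm f : bdm f -> bdm (fun x => `|f x|).
Proof.
move=> [mf [B fB]]; split; first exact: measurableT_comp.
by exists B => x; rewrite normr_id.
Qed.

Lemma bdm_sum (I : eqType) (r : seq I) (F : I -> T -> R) :
  (forall i, i \in r -> bdm (F i)) -> bdm (fun x => \sum_(i <- r) F i x).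
Proof.
elim: r => [|i r IH] bF.
  by apply: bdm_ext (bdm_cst 0) => x; rewrite big_nil.
apply: (@bdm_ext (fun x => F i x + \sum_(j <- r) F j x)).
  by move=> x; rewrite big_cons.
apply: bdmD; first by apply: bF; rewrite mem_head.
by apply: IH => j jr; apply: bF; rewrite inE jr orbT.
Qed.

Lemma bdm_cvg (u : nat -> T -> R) f (B : R) :
  (forall n, bdm (u n)) -> (forall x, u ^~ x @ \oo --> f x) ->
  (forall x, `|f x| <= B) -> bdm f.
Proof.
move=> bu uf fB; split; last by exists B.
apply: (@measurable_fun_cvg _ T R setT u) => [n|x _]; last exact: uf.
by have [] := bu n.
Qed.

End BoundedMeasurable.

Lemma bdm_comp d d' (T : measurableType d) (U : measurableType d')
    (R : realType) (h : U -> T) (f : T -> R) :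
  measurable_fun setT h -> bdm f -> bdm (f \o h).
Proof.
move=> mh [mf [B fB]]; split; last by exists B => x; exact: fB.
exact: measurableT_comp.
Qed.

Section Pairs.
Context d d' (T : measurableType d) (U : measurableType d') (R : realType).

Lemma bdm_fst (f : T -> R) : bdm f -> bdm (fun z : T * U => f z.1).
Proof. exact: bdm_comp (@measurable_fst _ _ _ _). Qed.

Lemma bdm_snd (f : U -> R) : bdm f -> bdm (fun z : T * U => f z.2).
Proof. exact: bdm_comp (@measurable_snd _ _ _ _). Qed.

Lemma bdm_pair1 (K : T * U -> R) x : bdm K -> bdm (fun y => K (x, y)).
Proof. exact: bdm_comp (@pair1_measurable _ _ _ _ _). Qed.

Lemma bdm_pair2 (K : T * U -> R) y : bdm K -> bdm (fun x => K (x, y)).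
Proof. exact: bdm_comp (@pair2_measurable _ _ _ _ _). Qed.

Lemma bdm_swap (K : T * U -> R) : bdm K -> bdm (fun z : U * T => K (z.2, z.1)).
Proof. exact: bdm_comp (@measurable_swap _ _ _ _). Qed.

End Pairs.

(** * Integration over a set of measure 1: Fubini and the scalar product *)

Section Mean.
Context d (T : measurableType d) (R : realType).
Variables (mu : {sigma_finite_measure set T -> \bar R}) (D : set T).
Hypotheses (mD : measurable D) (muD : (mu : {measure set T -> \bar R}) D = 1%:E).
Implicit Types f g : T -> R.

Let E f := \int[mu]_(x in D) f x.

Lemma bdm_integrable f : bdm f -> mu.-integrable D (EFin \o f).
Proof.
move=> [mf [B fB]]; apply: measurable_bounded_integrable => //.
- by rewrite muD ltry.
- exact: measurable_funTS.
- exists B; split; first exact: num_real.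
  by move=> M BM x _; exact: le_trans (fB x) (ltW BM).
Qed.
Hint Resolve bdm_integrable : core.

Lemma mean_ext f g : (forall x, D x -> f x = g x) -> E f = E g.
Proof. by move=> fg; apply: eq_Rintegral => x /set_mem; exact: fg. Qed.

Lemma mean_cst c : E (fun=> c) = c.
Proof. by rewrite /E Rintegral_cst// muD mulr1. Qed.

Lemma meanD f g : bdm f -> bdm g -> E (fun x => f x + g x) = E f + E g.
Proof. by move=> bf bg; rewrite /E RintegralD//; exact: bdm_integrable. Qed.

Lemma meanB f g : bdm f -> bdm g -> E (fun x => f x - g x) = E f - E g.
Proof. by move=> bf bg; rewrite /E RintegralB//; exact: bdm_integrable. Qed.

Lemma meanZ c f : bdm f -> E (fun x => c * f x) = c * E f.
Proof. by move=> bf; rewrite /E RintegralZl//; exact: bdm_integrable. Qed.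

Lemma mean_sum (I : eqType) (r : seq I) (F : I -> T -> R) :
  (forall i, i \in r -> bdm (F i)) ->
  E (fun x => \sum_(i <- r) F i x) = \sum_(i <- r) E (F i).
Proof.
elim: r => [|i r IH] bF.
  by rewrite big_nil -[RHS](mean_cst 0); apply: mean_ext => x _; rewrite big_nil.
rewrite big_cons -IH; last by move=> j jr; apply: bF; rewrite inE jr orbT.
rewrite -meanD; last 2 first.
- by apply: bF; rewrite mem_head.
- by apply: bdm_sum => j jr; apply: bF; rewrite inE jr orbT.
by apply: mean_ext => x _; rewrite big_cons.
Qed.

Lemma mean_ge0 f : (forall x, D x -> 0 <= f x) -> 0 <= E f.
Proof. exact: Rintegral_ge0. Qed.

Lemma le_mean f g : bdm f -> bdm g -> (forall x, D x -> f x <= g x) -> E f <= E g.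
Proof. by move=> bf bg fg; apply: le_Rintegral => //; exact: bdm_integrable. Qed.

Lemma le_norm_mean f : bdm f -> `|E f| <= E (fun x => `|f x|).
Proof. by move=> bf; apply: le_normr_Rintegral => //; exact: bdm_integrable. Qed.

Lemma mean_le_cst f c : bdm f -> (forall x, D x -> f x <= c) -> E f <= c.
Proof.
by move=> bf fc; rewrite -[leRHS]mean_cst; apply: le_mean => //; exact: bdm_cst.
Qed.

Lemma norm_mean_le f c : bdm f -> (forall x, D x -> `|f x| <= c) -> `|E f| <= c.
Proof.
move=> bf fc; rewrite (le_trans (le_norm_mean bf))//.
by apply: mean_le_cst => //; exact: bdm_norm.
Qed.

(** Adding the bound B makes the integrand nonnegative, so that Tonelli's theorem gives the
    measurability; the indicator of D turns the integral into one over the whole space. *)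
Lemma bdm_mean d' (U : measurableType d') (K : U * T -> R) :
  bdm K -> bdm (fun x => E (fun y => K (x, y))).
Proof.
move=> bK; have [mK [B KB]] := bK; split; last first.
  exists B => x; apply: norm_mean_le => [|y _]; last exact: KB.
  exact: bdm_pair1.
pose G (z : U * T) := (K z + B) * \1_D z.2.
have G0 z : 0 <= G z.
  by rewrite mulr_ge0// -lerBlDr sub0r; have /ler_normlP[] := KB z; lra.
have bG : bdm G.
  apply: bdmM; first by apply: bdmD => //; exact: bdm_cst.
  apply: bdm_snd; split; first exact: measurable_indic.
  by exists 1 => x; rewrite indicE; case: (_ \in _); rewrite ?normr1 ?normr0.
have -> : (fun x => E (fun y => K (x, y))) =
    (fun x => fine (\int[mu]_y (G (x, y))%:E) - B).
  apply/funext => x; apply/(canRL (addrK _)).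
  rewrite -[X in _ + X]mean_cst -meanD; last 2 first.
  - exact: bdm_pair1.
  - exact: bdm_cst.
  rewrite /E /Rintegral integral_mkcond; congr fine; apply: eq_integral => y _.
  rewrite patchE /G indicE; by case: ifP => _; rewrite ?mulr1 ?mulr0.
apply: measurable_funB => //.
apply: (@measurableT_comp _ _ _ _ _ _ fine).
  exact: (@fine_measurable R setT measurableT).
apply: (measurable_fun_fubini_tonelli_F (m2 := mu) (fun z => (G z)%:E)).
- by apply/measurable_EFinP; have [] := bG.
- by move=> z; rewrite lee_fin.
Qed.

(** Tonelli's theorem for the nonnegative shift K + B cut off to D x D; since D has measure 1, the
    shift adds the same B to both iterated integrals. *)
Lemma mean_swap (K : T * T -> R) : bdm K ->
  E (fun x => E (fun y => K (x, y))) = E (fun y => E (fun x => K (x, y))).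
Proof.
move=> bK; have [mK [B KB]] := bK.
pose G (z : T * T) := (K z + B) * (\1_D z.1 * \1_D z.2).
have G0 z : 0 <= G z.
  by rewrite mulr_ge0 ?mulr_ge0// -lerBlDr sub0r; have /ler_normlP[] := KB z; lra.
have b1 : bdm (\1_D : T -> R).
  split; first exact: measurable_indic.
  by exists 1 => x; rewrite indicE; case: (_ \in _); rewrite ?normr1 ?normr0.
have bG : bdm G.
  apply: bdmM; first by apply: bdmD => //; exact: bdm_cst.
  by apply: bdmM; [exact: bdm_fst|exact: bdm_snd].
have patch1 (g h : T -> R) : bdm h ->
    (forall x, g x = (h x + B) * \1_D x) ->
    (\int[mu]_x (g x)%:E = (E h + B)%:E)%E.
  move=> bh gE; rewrite -[X in (_ + X)%:E]mean_cst -meanD//; last exact: bdm_cst.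
  rewrite /E /Rintegral fineK; last first.
    apply: integrable_fin_num => //; apply: bdm_integrable.
    by apply: bdmD => //; exact: bdm_cst.
  rewrite [RHS]integral_mkcond; apply: eq_integral => x _.
  by rewrite patchE gE indicE; case: ifP => _; rewrite ?mulr1 ?mulr0.
have mG : measurable_fun setT (fun z => (G z)%:E).
  by apply/measurable_EFinP; have [] := bG.
have G0' z : (0 <= (G z)%:E)%E by rewrite lee_fin.
have inner1 x : (\int[mu]_y (G (x, y))%:E =
    ((E (fun y => K (x, y)) + B) * \1_D x)%:E)%E.
  have [xD|xD] := boolP (x \in D).
    rewrite indicE xD mulr1; apply: patch1; first exact: bdm_pair1.
    by move=> y; rewrite /G/= [\1_D x]indicE xD mul1r.
  rewrite indicE (negbTE xD) mulr0 integral0_eq// => y _.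
  by rewrite /G/= [\1_D x]indicE (negbTE xD) mul0r mulr0.
have inner2 y : (\int[mu]_x (G (x, y))%:E =
    ((E (fun x => K (x, y)) + B) * \1_D y)%:E)%E.
  have [yD|yD] := boolP (y \in D).
    rewrite indicE yD mulr1; apply: patch1; first exact: bdm_pair2.
    by move=> x; rewrite /G/= [\1_D y]indicE yD mulr1.
  rewrite indicE (negbTE yD) mulr0 integral0_eq// => x _.
  by rewrite /G/= [\1_D y]indicE (negbTE yD) !mulr0.
have := fubini_tonelli (m1 := mu) (m2 := mu) (fun z => (G z)%:E) mG G0'.
rewrite (eq_integral _ _ (fun x _ => inner1 x)).
rewrite (eq_integral _ _ (fun x _ => inner2 x)).
rewrite (patch1 _ (fun x => E (fun y => K (x, y)))) //; last exact: bdm_mean.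
rewrite (patch1 _ (fun y => E (fun x => K (x, y)))) //; last first.
  exact: (bdm_mean (bdm_swap bK)).
by move=> [/addIr].
Qed.

Definition scal f g := E (fun x => f x * g x).

Lemma scalC f g : scal f g = scal g f.
Proof. by apply: mean_ext => x _; rewrite mulrC. Qed.

Lemma scal_ge0 f : 0 <= scal f f.
Proof. by apply: mean_ge0 => x _; rewrite -expr2 sqr_ge0. Qed.

Lemma scalDr f g h : bdm f -> bdm g -> bdm h ->
  scal f (fun x => g x + h x) = scal f g + scal f h.
Proof.
move=> bf bg bh; rewrite -meanD; [|exact: bdmM..].
by apply: mean_ext => x _; rewrite mulrDr.
Qed.

Lemma scalZr f c g : bdm f -> bdm g -> scal f (fun x => c * g x) = c * scal f g.
Proof.
move=> bf bg; rewrite -meanZ; last exact: bdmM.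
by apply: mean_ext => x _; rewrite mulrCA.
Qed.

Lemma scal_sumr (I : eqType) (r : seq I) (F : I -> T -> R) f :
  bdm f -> (forall i, i \in r -> bdm (F i)) ->
  scal f (fun x => \sum_(i <- r) F i x) = \sum_(i <- r) scal f (F i).
Proof.
move=> bf bF; rewrite -mean_sum => [|i ir]; last by apply: bdmM => //; exact: bF.
by apply: mean_ext => x _; rewrite mulr_sumr.
Qed.

Lemma scal_lin2 a b f g : bdm f -> bdm g ->
  scal (fun x => a * f x + b * g x) (fun x => a * f x + b * g x) =
  a ^+ 2 * scal f f + 2 * a * b * scal f g + b ^+ 2 * scal g g.
Proof.
move=> bf bg.
have bff := bdmM bf bf; have bfg := bdmM bf bg; have bgg := bdmM bg bg.
rewrite /scal -!meanZ// -!meanD//; do ?[apply: bdmD|exact: bdmZ].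
by apply: mean_ext => x _; ring.
Qed.

End Mean.

(** For c > 0 the value of the form at (c, -b) is c (a c - b^2); the case c = 0 forces b = 0. *)
Lemma discriminant_le0 (R : realFieldType) (a b c : R) : 0 <= c ->
  (forall s t, 0 <= s ^+ 2 * a + 2 * s * t * b + t ^+ 2 * c) -> b ^+ 2 <= a * c.
Proof.
rewrite le_eqVlt => /predU1P[<- h|c0 h]; last first.
  by have := h c (- b); nra.
have [->|b0] := eqVneq b 0; first by rewrite expr0n mulr0.
(* With c = 0 and s = 1 the form is affine in t; this t gives it the value -1. *)
have := h 1 (- (a + 1) / (2 * b)).
suff -> : 1 ^+ 2 * a + 2 * 1 * (- (a + 1) / (2 * b)) * b +
  (- (a + 1) / (2 * b)) ^+ 2 * 0 = -1 by rewrite ler0N1.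
by field.
Qed.

(** * Growth of log-convex submultiplicative sequences *)

(** Log-convexity makes the ratios [e n.+1 / e n] nondecreasing, and r is their supremum. In the
    application [e n] belongs to the power n + 1 of an operator, hence the index [n.*2.+1] for the
    squared power and the exponent [n.+1]. *)
Lemma growth_rate (R : realType) (e : nat -> R) (B : R) :
  (forall n, 0 < e n) -> (forall n, e n.+1 ^+ 2 <= e n * e n.+2) ->
  (forall n, e n.*2.+1 <= e n ^+ 2) -> (forall n, e n.+1 <= B * e n) ->
  exists2 r, 0 < r & (forall n, e n.+1 <= r * e n) /\ forall n, r ^+ n.+1 <= e n.
Proof.
move=> e0 econvex esub eB.
pose q n := e n.+1 / e n.
have q0 n : 0 < q n by rewrite divr_gt0.
have qS n : q n <= q n.+1.
  by rewrite /q ler_pdivrMr// mulrAC ler_pdivlMr// -expr2 mulrC.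
have qmono : {homo q : m n / (m <= n)%N >-> m <= n}.
  by apply: homo_leq; [exact: lexx|exact: le_trans|].
have ubq : has_ubound (range q).
  by exists B => _ [n _ <-]; rewrite /q ler_pdivrMr.
have supq : has_sup (range q) by split=> //; exists (q 0%N); exists 0%N.
exists (sup (range q)).
  by rewrite (lt_le_trans (q0 0%N))//; apply: ub_le_sup => //; exists 0%N.
split=> [n|n].
  by rewrite -ler_pdivrMr//; apply: ub_le_sup => //; exists n.
set r := sup _; rewrite leNgt; apply/negP => enr.
have r0 : 0 < r by rewrite (lt_le_trans (q0 0%N))//; apply: ub_le_sup => //; exists 0%N.
(* If [e n] fell below [r ^+ n.+1], the midpoint of its (n+1)-st root and r would do. *)
have [t t0 [tr ent]] : exists2 t, 0 < t & t < r /\ e n < t ^+ n.+1.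
  pose u := e n `^ n.+1%:R^-1.
  have u0 : 0 < u by rewrite powR_gt0.
  have uE : u ^+ n.+1 = e n.
    by rewrite -powR_mulrn ?ltW// -powRrM mulVf// powRr1// ltW.
  have ur : u < r by move: enr; rewrite -uE ltr_pXn2r// nnegrE ltW.
  by exists ((u + r) / 2); [lra|split; [lra|rewrite -uE ltr_pXn2r// ?nnegrE; lra]].
(* From some K on all ratios exceed t, so e grows at least like the powers of t. *)
have [_ [K _ <-] tK] := sup_gt (proj1 supq) tr.
have eK m : e K * t ^+ m <= e (K + m)%N.
  elim: m => [|m IH]; first by rewrite expr0 mulr1 addn0.
  rewrite exprSr mulrA addnS (le_trans (ler_wpM2r (ltW t0) IH))//.
  have : t <= q (K + m)%N by rewrite (le_trans (ltW tK))// qmono// leq_addr.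
  by rewrite /q ler_pdivlMr// mulrC.
(* Along the indices 2^m (n + 1) - 1 the submultiplicativity would force [e] to
   decay faster than its ratios, which exceed [t] from [K] on, allow. *)
pose idx m := (2 ^ m * n.+1).-1.
have idxS m : (idx m).+1 = (2 ^ m * n.+1)%N by rewrite prednK// muln_gt0 expn_gt0.
have eidx m : e (idx m) <= e n ^+ (2 ^ m).
  elim: m => [|m IH]; first by rewrite /idx mul1n.
  have -> : idx m.+1 = (idx m).*2.+1.
    by apply: succn_inj; rewrite idxS -doubleS idxS expnS -mulnA mul2n.
  rewrite (le_trans (esub _))// expnSr exprM lerXn2r// nnegrE ltW//.
  by rewrite exprn_gt0.
(* z is less than 1, yet its powers would stay above the fixed positive [kappa]. *)
pose z := e n / t ^+ n.+1.
have z0 : 0 < z by rewrite divr_gt0// exprn_gt0.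
have z1 : z < 1 by rewrite ltr_pdivrMr ?mul1r// exprn_gt0.
pose kappa := e K / t ^+ K.+1.
have kappa0 : 0 < kappa by rewrite divr_gt0// exprn_gt0.
have kz m : (K <= m)%N -> kappa <= z ^+ m.
  move=> Km.
  have Kidx : (K <= idx m)%N.
    rewrite -ltnS idxS; have := ltn_expl m (isT : 1 < 2)%N.
    have : (2 ^ m <= 2 ^ m * n.+1)%N by rewrite leq_pmulr.
    lia.
  have zE : z ^+ (2 ^ m) = e n ^+ (2 ^ m) / t ^+ (idx m).+1.
    by rewrite /z expr_div_n -exprM mulnC idxS.
  apply: (@le_trans _ _ (z ^+ (2 ^ m))); last first.
    apply: ler_wiXn2l; rewrite ?ltW//; have := ltn_expl m (isT : 1 < 2)%N; lia.
  rewrite zE ler_pdivlMr ?exprn_gt0// (le_trans _ (eidx m))//.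
  have := eK (idx m - K)%N; rewrite subnKC// => /(le_trans _); apply.
  rewrite /kappa -mulrA ler_pM2l// mulrC ler_pdivrMr ?exprn_gt0//.
  by rewrite -exprD; have -> : (idx m - K + K.+1 = (idx m).+1)%N by lia.
have nz : `|z| < 1 by rewrite ger0_norm ?ltW.
have [M _ MH] := (cvgr0Pnorm_lt _).1 (cvg_expr nz) _ kappa0.
have := MH (maxn M K) (leq_maxl _ _); rewrite /= ger0_norm ?exprn_ge0 ?ltW//.
by rewrite ltNge kz// leq_maxr.
Qed.

(** Completeness gives the pointwise limit; letting l tend to infinity keeps the rate uniform in x,
    and the limit is bounded because it stays within 1 of a bounded function. *)
Lemma bdm_unif_lim d (T : measurableType d) (R : realType) (u : nat -> T -> R) :
  (forall n, bdm (u n)) ->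
  (forall eps, 0 < eps -> exists K, forall k l, (K <= k)%N -> (K <= l)%N ->
     forall x, `|u k x - u l x| <= eps) ->
  exists2 g, bdm g & forall eps, 0 < eps -> exists K, forall k, (K <= k)%N ->
     forall x, `|u k x - g x| <= eps.
Proof.
move=> bu cu.
have cvgu x : cvg (u n x @[n --> \oo]).
  apply/cauchy_cvgP/cauchy_exP => eps /= eps0.
  have e20 : 0 < eps / 2 by rewrite divr_gt0.
  have [K HK] := cu _ e20.
  exists (u K x); exists K => // n /= Kn; rewrite /ball/=.
  by rewrite (le_lt_trans (HK _ _ _ _ x))// ltr_pdivrMr// mulr_natr mulr2n ltrDl.
pose g x := lim (u n x @[n --> \oo]).
have gP eps : 0 < eps -> exists K, forall k, (K <= k)%N ->
    forall x, `|u k x - g x| <= eps.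
  move=> eps0; have [K HK] := cu _ eps0; exists K => k Kk x.
  have cd : `|u k x - u n x| @[n --> \oo] --> `|u k x - g x|.
    by apply: cvg_norm; apply: cvgB; [exact: cvg_cst|exact: cvgu].
  have <- := cvg_lim (@Rhausdorff R) cd.
  apply: limr_le; first by apply/cvg_ex; exists `|u k x - g x|.
  by exists K => // n /= Kn; exact: HK.
exists g => //.
have [K /(_ K (leqnn _)) HK] := gP 1 ltr01.
have [_ [B uB]] := bu K.
apply: (@bdm_cvg _ _ _ u g (B + 1)) => // x.
have := HK x; have := uB x; rewrite distrC => ? ?.
by rewrite -[g x](subrK (u K x)) addrC (le_trans (ler_normD _ _))// lerD.
Qed.

(** The ratios are nondecreasing, so a first ratio above c keeps all later ones above c. *)
Lemma log_convex_growth (R : realFieldType) (m : nat -> R) (c : R) :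
  0 < m 0%N -> 0 <= c -> c * m 0%N < m 1%N ->
  (forall k, m k.+1 ^+ 2 <= m k * m k.+2) ->
  forall n, c ^+ n.+1 * m 0%N < m n.+1.
Proof.
move=> m0 c0 cm mconv n.
have mS k : 0 < m k /\ c * m k < m k.+1.
  elim: k => [|k [mk0 mk1]]; first by [].
  have mk1' : 0 < m k.+1 by rewrite (le_lt_trans _ mk1)// mulr_ge0// ltW.
  split=> //; rewrite -(ltr_pM2l mk0) (lt_le_trans _ (mconv k))//.
  by rewrite mulrA [m k * c]mulrC expr2 ltr_pM2r.
have mn k : c ^+ k * m 0%N <= m k.
  elim: k => [|k IH]; first by rewrite mul1r.
  rewrite exprS -mulrA (le_trans (ler_wpM2l c0 IH))// ltW//.
  by have [] := mS k.
rewrite exprS -mulrA (le_lt_trans (ler_wpM2l c0 (mn n)))//.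
by have [] := mS n.
Qed.

(** * Iterates of a symmetric kernel *)

Section SymmetricKernel.
Context d (T : measurableType d) (R : realType).
Variables (mu : {sigma_finite_measure set T -> \bar R}) (D : set T).
Hypotheses (mD : measurable D) (muD : (mu : {measure set T -> \bar R}) D = 1%:E).
Implicit Types f g u : T -> R.

Local Notation E f := (\int[mu]_(x in D) f x).
Local Notation dot := (scal mu D).

Lemma scal_cauchy_schwarz f g : bdm f -> bdm g ->
  dot f g ^+ 2 <= dot f f * dot g g.
Proof.
move=> bf bg; apply: discriminant_le0 => [|s t]; first exact: scal_ge0.
rewrite -(scal_lin2 mD muD)//; exact: scal_ge0.
Qed.

(** With w the projection of u, both <u, w> and <w, w> equal the sum of squares; expand <u - w, u -
    w> >= 0. *)
Lemma bessel (I : eqType) (r : seq I) (phi : I -> T -> R) u :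
  bdm u -> (forall i, i \in r -> bdm (phi i)) -> uniq r ->
  {in r &, forall i j, dot (phi i) (phi j) = (i == j)%:R} ->
  \sum_(i <- r) dot u (phi i) ^+ 2 <= dot u u.
Proof.
move=> bu bphi ur ortho.
pose w x := \sum_(i <- r) dot u (phi i) * phi i x.
have bw : bdm w by apply: bdm_sum => i ir; apply: bdmZ; exact: bphi.
have bwi i : i \in r -> bdm (fun x => dot u (phi i) * phi i x).
  by move=> ir; apply: bdmZ; exact: bphi.
have uw : dot u w = \sum_(i <- r) dot u (phi i) ^+ 2.
  rewrite /w (scal_sumr mD muD)//; apply: eq_big_seq => i ir.
  by rewrite (scalZr mD muD)//; exact: bphi.
have ww : dot w w = \sum_(i <- r) dot u (phi i) ^+ 2.
  rewrite {2}/w (scal_sumr mD muD)//; apply: eq_big_seq => i ir.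
  rewrite (scalZr mD muD)//; last exact: bphi.
  rewrite [dot w _]scalC /w (scal_sumr mD muD)//; last exact: bphi.
  rewrite expr2; congr (_ * _); rewrite (bigD1_seq i)//=.
  rewrite (scalZr mD muD)//; [|exact: bphi..].
  rewrite ortho// eqxx mulr1 big1_seq ?addr0// => j /andP[ji jr].
  rewrite (scalZr mD muD)//; [|exact: bphi..].
  by rewrite ortho// eq_sym (negbTE ji) mulr0.
have := scal_ge0 mu D (fun x => 1 * u x + (-1) * w x).
by rewrite (scal_lin2 mD muD)// uw ww; lra.
Qed.

Variable S : T * T -> R.
Hypotheses (bS : bdm S) (symS : forall x y, S (x, y) = S (y, x)).

(** Only D is integrated over, but x ranges over the whole space, so an eigenvalue equation can be
    required at every point of T. *)
Definition kop f x := E (fun y => S (x, y) * f y).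

Let kern_row_bdm x : bdm (fun y => S (x, y)).
Proof. exact: bdm_pair1. Qed.

Lemma kop_bdm f : bdm f -> bdm (kop f).
Proof.
move=> bf; apply: (@bdm_mean _ _ _ _ _ mD muD _ T (fun z => S z * f z.2)).
by apply: bdmM => //; exact: bdm_snd.
Qed.

Lemma kop_sym f g : bdm f -> bdm g -> dot (kop f) g = dot f (kop g).
Proof.
move=> bf bg.
transitivity (E (fun x => E (fun y => S (x, y) * f y * g x))).
  apply: mean_ext => x _; rewrite mulrC -(meanZ mD muD).
    by apply: mean_ext => y _; rewrite mulrC.
  exact: bdmM.
rewrite (mean_swap mD muD (K := fun z => S z * f z.2 * g z.1)); last first.
  by apply: bdmM; [apply: bdmM => //; exact: bdm_snd|exact: bdm_fst].
apply: mean_ext => y _ /=; rewrite -(meanZ mD muD); last exact: bdmM.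
by apply: mean_ext => x _; rewrite symS mulrCA mulrA.
Qed.

Lemma kopZ c f x : bdm f -> kop (fun y => c * f y) x = c * kop f x.
Proof. by move=> bf; exact: (scalZr mD muD). Qed.

Lemma kopB f g x : bdm f -> bdm g ->
  kop (fun y => f y - g y) x = kop f x - kop g x.
Proof.
move=> bf bg; rewrite /kop -(meanB mD muD); [|exact: bdmM..].
by apply: mean_ext => y _; rewrite mulrBr.
Qed.

Lemma kopD f g x : bdm f -> bdm g ->
  kop (fun y => f y + g y) x = kop f x + kop g x.
Proof. by move=> bf bg; exact: (scalDr mD muD). Qed.

Definition kopn n := iter n kop.

Lemma kopn_bdm n f : bdm f -> bdm (kopn n f).
Proof. by move=> bf; elim: n => //= n; exact: kop_bdm. Qed.

Lemma kopn_sym n f g : bdm f -> bdm g -> dot (kopn n f) g = dot f (kopn n g).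
Proof.
move=> bf; elim: n g => // n IH g bg.
have -> : kopn n.+1 f = kop (kopn n f) by [].
have -> : kopn n.+1 g = kopn n (kop g) by rewrite /kopn iterSr.
by rewrite (kop_sym (kopn_bdm n bf) bg) IH//; exact: kop_bdm.
Qed.

(* Iterated kernels: [kern n] is the kernel of the (n+1)-st power of [kop]. *)
Definition kern n (z : T * T) := kopn n (fun x => S (x, z.2)) z.1.

Lemma kernS n x y : kern n.+1 (x, y) = E (fun z => S (x, z) * kern n (z, y)).
Proof. by []. Qed.

Lemma kern_bdm n : bdm (kern n).
Proof.
elim: n => [|n IH].
  by apply: bdm_ext bS => -[x y].
apply: (@bdm_ext _ _ _ (fun w => E (fun z => S (w.1, z) * kern n (z, w.2)))).
  by case=> x y; rewrite kernS.
apply: (@bdm_mean _ _ _ _ _ mD muD _ _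
  (fun w : (T * T) * T => S (w.1.1, w.2) * kern n (w.2, w.1.2))).
have m1 := @measurable_fst _ _ (T * T)%type T.
have m2 := @measurable_snd _ _ (T * T)%type T.
apply: bdmM.
  apply: (bdm_comp (h := fun w : (T * T) * T => (w.1.1, w.2))) bS.
  by apply: measurable_fun_pair => //; exact: measurableT_comp m1.
apply: (bdm_comp (h := fun w : (T * T) * T => (w.2, w.1.2))) IH.
by apply: measurable_fun_pair => //; exact: measurableT_comp m1.
Qed.

Definition kcol n y x := kern n (x, y).

Lemma kcol_bdm n y : bdm (kcol n y).
Proof. exact: bdm_pair2 (kern_bdm n). Qed.
Lemma kcolE n y x : kcol n y x = kern n (x, y).
Proof. by []. Qed.

Lemma kernE n x y : kern n.+1 (x, y) = kop (kcol n y) x.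
Proof. by []. Qed.

Lemma kcolS n y : kcol n.+1 y = kop (kcol n y).
Proof. by []. Qed.

#[local] Hint Resolve kcol_bdm : core.

(** Symmetry moves the m extra powers across the product. Index n being the power n + 1, composing
    the indices n and m gives the index n + m + 1. *)
Lemma scal_kcol n m y z : dot (kcol n y) (kcol m z) = kern (n + m).+1 (z, y).
Proof.
have -> : dot (kcol n y) (kcol m z) = dot (kcol 0 z) (kopn m (kcol n y)).
  by rewrite scalC -kopn_sym//; exact: kcol_bdm.
have -> : kopn m (kcol n y) = kcol (n + m) y.
  by apply/funext => x; rewrite /kcol /kern /kopn addnC iterD.
rewrite kernS; apply: mean_ext => x _; congr (_ * _).
by rewrite /kcol /kern /= symS.
Qed.

Lemma kern_sym n x y : kern n (x, y) = kern n (y, x).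
Proof.
case: n => [|n]; first exact: symS.
by rewrite -(addn0 n) -scal_kcol scalC scal_kcol add0n addn0.
Qed.

(** The trace of the (n+1)-st power of the operator. *)
Definition ktrace n := E (fun y => kern n (y, y)).

Lemma kern_diag_bdm n : bdm (fun y => kern n (y, y)).
Proof.
apply: (bdm_comp (h := fun y : T => (y, y))) (kern_bdm n).
by apply: measurable_fun_pair.
Qed.

(* [khs n] is the squared Hilbert-Schmidt norm of the (n+1)-st power. *)
Definition khs n := ktrace n.*2.+1.

Lemma khs_trace n : khs n = ktrace n.*2.+1.
Proof. by []. Qed.

Lemma khsE n : khs n = E (fun y => dot (kcol n y) (kcol n y)).
Proof. by apply: mean_ext => y _; rewrite scal_kcol addnn. Qed.

(** The squared Hilbert-Schmidt norm of a combination of two powers, the mixed product being a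
    trace. It yields the log-convexity of the norms and, later, the Cauchy property of the
    normalised powers. *)
Lemma khs_lin2 n m s t :
  E (fun y => dot (fun x => s * kcol n y x + t * kcol m y x)
                  (fun x => s * kcol n y x + t * kcol m y x)) =
  s ^+ 2 * khs n + 2 * s * t * ktrace (n + m).+1 + t ^+ 2 * khs m.
Proof.
rewrite /khs /ktrace -!(meanZ mD muD)//; [|exact: kern_diag_bdm..].
do 2 (rewrite -(meanD mD muD)//; do ?[apply: bdmD|apply: bdmZ|exact: kern_diag_bdm]).
apply: mean_ext => y _; rewrite (scal_lin2 mD muD)//.
by rewrite !scal_kcol !addnn.
Qed.

Lemma khs_ge0 n : 0 <= khs n.
Proof. by rewrite khsE; apply: mean_ge0 => y _; exact: scal_ge0. Qed.

(** Cauchy-Schwarz for the Hilbert-Schmidt product of the powers of index n and n + 2, which is the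
    trace of index 2n + 3, that is [khs n.+1]. *)
Lemma khs_convex n : khs n.+1 ^+ 2 <= khs n * khs n.+2.
Proof.
apply: discriminant_le0 => [|s t]; first exact: khs_ge0.
have -> : khs n.+1 = ktrace (n + n.+2).+1 by congr ktrace; lia.
by rewrite -khs_lin2; apply: mean_ge0 => y _; exact: scal_ge0.
Qed.

(** A value of the kernel of index 2n + 1 is a scalar product of two columns of index n;
    Cauchy-Schwarz bounds its square by a product of functions of one variable, which integrates to
    [khs n ^+ 2]. *)
Lemma khs_submul n : khs n.*2.+1 <= khs n ^+ 2.
Proof.
rewrite khsE expr2.
have b2 : bdm (fun y => dot (kcol n.*2.+1 y) (kcol n.*2.+1 y)).
  apply: (bdm_ext _ (kern_diag_bdm (n.*2.+1).*2.+1)) => y.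
  by rewrite scal_kcol addnn.
rewrite -[leRHS](meanZ mD muD); last exact: kern_diag_bdm.
apply: le_mean => // [|y _].
  by apply: bdmZ; exact: kern_diag_bdm.
rewrite mulrC -(meanZ mD muD); last exact: kern_diag_bdm.
apply: (le_mean mD muD) => [||x _].
- exact: bdmM.
- by apply: bdmZ; exact: kern_diag_bdm.
rewrite -expr2 /kcol -!addnn -!scal_kcol.
exact: scal_cauchy_schwarz.
Qed.

(** Cauchy-Schwarz against each row: the Hilbert-Schmidt norm dominates the operator norm. *)
Lemma kop_norm f : bdm f -> dot (kop f) (kop f) <= khs 0 * dot f f.
Proof.
move=> bf; rewrite khsE mulrC -(meanZ mD muD); last first.
  apply: (bdm_ext _ (kern_diag_bdm 1)) => y.
  by rewrite scal_kcol.
apply: (le_mean mD muD) => [||x _].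
- by apply: bdmM; exact: kop_bdm.
- apply: bdmZ; apply: (bdm_ext _ (kern_diag_bdm 1)) => y.
  by rewrite scal_kcol.
have -> : kcol 0 x = (fun y => S (x, y)) by apply/funext => y; rewrite /kcol symS.
by rewrite -expr2 mulrC; exact: scal_cauchy_schwarz.
Qed.

(** Applies [kop_norm] to each column; this bounds the ratios in [growth_rate]. *)
Lemma khs_bound n : khs n.+1 <= khs 0 * khs n.
Proof.
have bc k : bdm (fun y => dot (kcol k y) (kcol k y)).
  apply: (bdm_ext _ (kern_diag_bdm k.*2.+1)) => y.
  by rewrite scal_kcol addnn.
rewrite !(khsE n.+1) (khsE n) -(meanZ mD muD)//.
apply: (le_mean mD muD) => // [|y _]; first exact: bdmZ.
by rewrite kcolS; apply: kop_norm; exact: kcol_bdm.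
Qed.

Lemma kopn_kern n f x : bdm f ->
  kopn n.+1 f x = E (fun y => kern n (x, y) * f y).
Proof.
move=> bf; elim: n x => // n IH x.
have -> : kopn n.+2 f x = E (fun z => S (x, z) * kopn n.+1 f z) by [].
transitivity (E (fun z => E (fun y => S (x, z) * (kern n (z, y) * f y)))).
  apply: mean_ext => z _; rewrite IH -(meanZ mD muD)//.
  by apply: bdmM => //; exact: bdm_pair1 (kern_bdm n).
rewrite (mean_swap mD muD (K := fun w => S (x, w.1) * (kern n w * f w.2))).
  apply: mean_ext => y _ /=; rewrite kernS [RHS]mulrC -(meanZ mD muD).
    by apply: mean_ext => z _; rewrite mulrA mulrC.
  by apply: bdmM => //; exact: kcol_bdm.
apply: bdmM; first exact: (@bdm_fst _ _ T T R (fun z => S (x, z)) (kern_row_bdm x)).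
by apply: bdmM; [exact: kern_bdm|exact: bdm_snd].
Qed.

Lemma kopn_norm n f : bdm f -> dot (kopn n.+1 f) (kopn n.+1 f) <= khs n * dot f f.
Proof.
move=> bf; rewrite khsE mulrC -(meanZ mD muD); last first.
  apply: (bdm_ext _ (kern_diag_bdm n.*2.+1)) => y.
  by rewrite scal_kcol addnn.
apply: (le_mean mD muD) => [||x _].
- by apply: bdmM; exact: kopn_bdm.
- apply: bdmZ; apply: (bdm_ext _ (kern_diag_bdm n.*2.+1)) => y.
  by rewrite scal_kcol addnn.
have -> : kcol n x = (fun y => kern n (x, y)).
  by apply/funext => y; rewrite /kcol kern_sym.
rewrite -expr2 mulrC kopn_kern//; apply: scal_cauchy_schwarz => //.
exact: bdm_pair1 (kern_bdm n).
Qed.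


End SymmetricKernel.

(** * Existence of an eigenvalue above the quadratic form *)

(** Two values at most eta above L and a middle value at least L have second difference at most 2
    eta. The factor M + 1 allows eta to be obtained from e by division even when M = 0. *)
Lemma cauchy_defect_le (R : realFieldType) (M eta L x y z e : R) :
  0 <= M -> 0 <= eta -> x <= L + eta -> y <= L + eta -> L <= z ->
  eta * (2 * (M + 1)) = e -> M * (x - 2 * z + y) <= e.
Proof.
move=> M0 eta0 xL yL zL <-.
have le2 : x - 2 * z + y <= 2 * eta by lra.
by apply: (le_trans (ler_wpM2l M0 le2)); nra.
Qed.

Opaque khs kern kcol ktrace kop kopn.

Section TopEigenvalue.
Context d (T : measurableType d) (R : realType).
Variables (mu : {sigma_finite_measure set T -> \bar R}) (D : set T).
Hypotheses (mD : measurable D) (muD : (mu : {measure set T -> \bar R}) D = 1%:E).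
Variable S : T * T -> R.
Hypotheses (bS : bdm S) (symS : forall x y, S (x, y) = S (y, x)).
Implicit Types f g u : T -> R.

Local Notation E f := (\int[mu]_(x in D) f x).
Local Notation dot := (scal mu D).
Local Notation kop := (kop mu D S).
Local Notation kopn := (kopn mu D S).
Local Notation kern := (kern mu D S).
Local Notation kcol := (kcol mu D S).
Local Notation khs := (khs mu D S).
Local Notation ktrace := (ktrace mu D S).

Let cs := scal_cauchy_schwarz mD muD.
Let kop_bdm := kop_bdm mD muD bS.
Let kopn_bdm := kopn_bdm mD muD bS.
Let kop_sym := kop_sym mD muD bS symS.
Let kopZ := kopZ mD muD bS.
Let kopD := kopD mD muD bS.
Let kopB := kopB mD muD bS.
Let kern_bdm := kern_bdm mD muD bS.
Let kern_sym := kern_sym mD muD bS symS.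
Let kcol_bdm := kcol_bdm mD muD bS.
Let kernE := kernE mu D S.
Let khs_lin2 := khs_lin2 mD muD bS symS.
Let kopn_norm := kopn_norm mD muD bS symS.

(** By symmetry and Cauchy-Schwarz the squared norms of the iterates of f are log-convex, so they
    outgrow the powers of c, and [khs n] dominates the growth under the power n + 1. *)
Let khs_gt0 f n (c : R) : bdm f -> 0 < dot f f -> 0 <= c ->
  c * dot f f < dot (kop f) (kop f) -> c ^+ n.+1 < khs n.
Proof.
move=> bf f0 c0 cf.
pose m k := dot (kopn k f) (kopn k f).
have mconv k : m k.+1 ^+ 2 <= m k * m k.+2.
  have -> : m k.+1 = dot (kopn k f) (kopn k.+2 f).
    exact: (kop_sym (kopn_bdm k bf) (kopn_bdm k.+1 bf)).
  by apply: cs; exact: kopn_bdm.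
rewrite -(ltr_pM2r f0); apply: lt_le_trans (kopn_norm n bf).
exact: (log_convex_growth (m := m)).
Qed.

(** Turns mean-square smallness into uniform smallness after one application of the operator. *)
Let kop_sup B f x : (forall z, `|S z| <= B) -> bdm f ->
  kop f x ^+ 2 <= B ^+ 2 * dot f f.
Proof.
move=> SB bf; apply: (le_trans (cs (bdm_pair1 x bS) bf)).
apply: ler_wpM2r; first exact: scal_ge0.
apply: (mean_le_cst mD muD); first by have b := bdm_pair1 x bS; exact: bdmM.
move=> y _; have B0 : 0 <= B by exact: le_trans (normr_ge0 _) (SB (x, y)).
by rewrite -expr2 -[leLHS]real_normK ?num_real// lerXn2r// nnegrE.
Qed.

(** A column of the power 2(n + 1) divided by [r ^+ n.+1]. Only even powers are taken, since S may
    have both sqrt r and - sqrt r as eigenvalues. *)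
Let a r n y x := kern n.*2.+1 (x, y) / r ^+ n.+1.

Let kop_a r n y z :
  kop (a r n z) y = (r ^+ n.+1)^-1 * kcol n.*2.+2 y z.
Proof.
have -> : a r n z = (fun w => (r ^+ n.+1)^-1 * kcol n.*2.+1 z w).
  by apply/funext => w; rewrite mulrC.
rewrite (kopZ _ y (kcol_bdm n.*2.+1 z)) -(kernE _ y z).
by rewrite kern_sym.
Qed.

(** One application of S is made in each variable, so that a Hilbert-Schmidt bound on one iterate
    becomes a uniform bound on the next. *)
Let aS r n y x : r != 0 -> a r n.+1 y x = r^-1 * kop (fun z => kop (a r n z) y) x.
Proof.
move=> r0; rewrite (funext (kop_a r n y)) (kopZ _ x (kcol_bdm n.*2.+2 y)).
rewrite -(kernE _ x y) mulrA -invfM -exprS.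
by rewrite mulrC /a doubleS.
Qed.

Lemma eigenvalue_above f delta : bdm f -> 0 <= delta ->
  delta * dot f f < `|dot f (kop f)| ->
  exists nu g, [/\ delta < `|nu|, bdm g, exists x, g x != 0 &
    forall x, kop g x = nu * g x].
Proof.
move=> bf delta0 deltaf.
have bkf := kop_bdm bf.
have csf := cs bf bkf.
have f0 : 0 < dot f f.
  rewrite lt_neqAle scal_ge0 andbT; apply/eqP => f0.
  move: csf deltaf; rewrite -f0 mulr0 mul0r => csf.
  have /eqP -> : dot f (kop f) == 0 by rewrite -sqrf_eq0 eq_le csf sqr_ge0.
  by rewrite normr0 ltxx.
(* Squares the assumption and compares with <f, S f>^2 <= <f, f> <S f, S f>. *)
have kf : delta ^+ 2 * dot f f < dot (kop f) (kop f).
  rewrite -(ltr_pM2l f0) (lt_le_trans _ csf)// -[ltRHS]real_normK ?num_real//.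
  have -> : dot f f * (delta ^+ 2 * dot f f) = (delta * dot f f) ^+ 2 by ring.
  by rewrite ltrXn2r// ?nnegrE ?mulr_ge0// ltW.
pose m1 := dot (kop f) (kop f) / dot f f.
(* The margin between c and [delta ^+ 2] makes the final inequality delta < sqrt r strict. *)
have [c [dc cm1]] : exists c, delta ^+ 2 < c /\ c < m1.
  exists ((delta ^+ 2 + m1) / 2).
  by move: kf; rewrite -ltr_pdivlMr// -/m1 => ?; split; lra.
have c0 : 0 < c by rewrite (le_lt_trans _ dc)// sqr_ge0.
have hsc n : c ^+ n.+1 < khs n.
  by apply: (khs_gt0 n bf f0 (ltW c0)); rewrite -ltr_pdivlMr.
have hs0 n : 0 < khs n by rewrite (lt_trans _ (hsc n))// exprn_gt0.
have [r r0 [hsr rhs]] := growth_rate hs0 (khs_convex mD muD bS symS)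
  (khs_submul mD muD bS symS) (khs_bound mD muD bS symS).
(* Otherwise [khs n], which is at most [r ^+ n * khs 0], could not exceed [c ^+ n.+1] for all n. *)
have cr : c <= r.
  rewrite leNgt; apply/negP => rc.
  have hsrn n : khs n <= r ^+ n * khs 0.
    elim: n => [|n IH]; first by rewrite mul1r.
    by rewrite exprS -mulrA (le_trans (hsr n))// ler_wpM2l// ltW.
  have nz : `|r / c| < 1.
    by rewrite ger0_norm ?divr_ge0 ?ltW// ltr_pdivrMr// mul1r.
  have eps0 : 0 < c / khs 0 by rewrite divr_gt0.
  have [N _ NH] := (cvgr0Pnorm_lt _).1 (cvg_expr nz) _ eps0.
  have := NH N (leqnn _); rewrite /= ger0_norm ?exprn_ge0 ?divr_ge0 ?ltW//.
  rewrite ltNge ler_pdivrMr// expr_div_n mulrAC ler_pdivlMr ?exprn_gt0//.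
  by rewrite -exprS (le_trans (ltW (hsc N))).
(* The normalised norms are nonincreasing and at least 1, hence converge to their infimum L. *)
pose C n := khs n / r ^+ n.+1.
have C1 n : 1 <= C n by rewrite ler_pdivlMr ?exprn_gt0// mul1r.
have CS n : C n.+1 <= C n.
  rewrite /C exprS invfM mulrA ler_pM2r ?invr_gt0 ?exprn_gt0//.
  by rewrite ler_pdivrMr// mulrC hsr.
have Cmono : {homo C : m n / (m <= n)%N >-> n <= m}.
  by apply: homo_leq => // [x y z xy yz]; exact: le_trans yz xy.
have lbC : has_lbound (range C) by exists 1 => _ [n _ <-].
have infC : has_inf (range C) by split=> //; exists (C 0); exists 0.
pose L := inf (range C).
have CL n : L <= C n by apply: ge_inf => //; exists n.
have Ceps eps : 0 < eps -> exists K, forall n, (K <= n)%N -> C n <= L + eps.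
  move=> eps0; have [_ [K _ <-] CK] := inf_adherent eps0 infC.
  by exists K => n Kn; rewrite (le_trans (Cmono _ _ Kn))// ltW.
have [_ [B SB]] := bS.
have ba n y : bdm (a r n y).
  by apply: (bdm_ext _ (bdmZ (r ^+ n.+1)^-1 (kcol_bdm n.*2.+1 y))) => x; rewrite mulrC.
have r0' : r != 0 by rewrite gt_eqF.
(* The difference of the next iterates is S applied in each variable to the difference h of the
   present ones; [kop_sup] is used twice, and the squared Hilbert-Schmidt norm of h is the second
   difference of C. *)
have diff k l x y : (a r k.+1 y x - a r l.+1 y x) ^+ 2 <=
    (r^-1 * B ^+ 2) ^+ 2 * (C k.*2.+1 - 2 * C (k + l).+1 + C l.*2.+1).
  pose h z w := (r ^+ k.+1)^-1 * kcol k.*2.+1 z w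
             + (- (r ^+ l.+1)^-1) * kcol l.*2.+1 z w.
  have hE z w : h z w = a r k z w - a r l z w by rewrite /h /a !kcolE; ring.
  have bh z : bdm (h z) by apply: bdmD; exact: bdmZ.
  pose H z := kop (h z) y.
  have HE z : H z = kop (a r k z) y - kop (a r l z) y.
    by rewrite -kopB//; congr (kop _ y); apply/funext => w.
  have bker k' : bdm (fun z => kop (a r k' z) y).
    by rewrite (funext (kop_a r k' y)); exact: bdmZ.
  have bH : bdm H.
    by apply: (bdm_ext _ (bdmB (bker k) (bker l))) => z; rewrite HE.
  have -> : a r k.+1 y x - a r l.+1 y x = r^-1 * kop H x.
    rewrite !aS// -mulrBr; congr (_ * _).
    by rewrite -kopB//; congr (kop _ x); apply/funext => w.
  have := khs_lin2 k.*2.+1 l.*2.+1 (r ^+ k.+1)^-1 (- (r ^+ l.+1)^-1).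
  rewrite (_ : (k.*2.+1 + l.*2.+1).+1 = (k + l).+1.*2.+1); last first.
    by rewrite addSn addnS -doubleD.
  rewrite -(khs_trace mu D S).
  have -> : ((r ^+ k.+1)^-1) ^+ 2 * khs k.*2.+1 = C k.*2.+1.
    by rewrite /C exprVn -exprM muln2 mulrC.
  have -> : (- (r ^+ l.+1)^-1) ^+ 2 * khs l.*2.+1 = C l.*2.+1.
    by rewrite /C sqrrN exprVn -exprM muln2 mulrC.
  have -> : 2 * (r ^+ k.+1)^-1 * - (r ^+ l.+1)^-1 * khs (k + l).+1 =
      - (2 * C (k + l).+1).
    rewrite /C; have -> : (k + l).+2 = (k.+1 + l.+1)%N by rewrite addSn addnS.
    by rewrite exprD invfM; ring.
  move=> <-; rewrite exprMn [in leRHS]exprMn -[leRHS]mulrA.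
  apply: ler_wpM2l; first exact: sqr_ge0.
  apply: (le_trans (kop_sup x SB bH)).
  rewrite [in leRHS]expr2 -[leRHS]mulrA.
  apply: ler_wpM2l; first exact: sqr_ge0.
  have bhh : bdm (fun z => dot (h z) (h z)).
    apply: (bdm_mean mD muD (K := fun p => h p.1 p.2 * h p.1 p.2)).
    have bk n : bdm (fun p : T * T => kcol n p.1 p.2).
      exact: bdm_swap (kern_bdm n).
    by apply: bdmM; apply: bdmD; apply: bdmZ.
  rewrite -(meanZ mD muD _ bhh).
  apply: (le_mean mD muD) => [||z _].
  - exact: bdmM.
  - exact: bdmZ.
  by rewrite -expr2; apply: kop_sup.
pose M := (r^-1 * B ^+ 2) ^+ 2.
have M0 : 0 <= M by exact: sqr_ge0.
have unif eps : 0 < eps -> exists K, forall k l, (K <= k)%N -> (K <= l)%N ->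
    forall y x, `|a r k y x - a r l y x| <= eps.
  move=> eps0; pose eta := eps ^+ 2 / (2 * (M + 1)).
  have eta0 : 0 < eta by rewrite divr_gt0 ?exprn_gt0// mulr_gt0// ltr_wpDl.
  have [K HK] := Ceps _ eta0.
  (* The successor matches [diff], which speaks of the iterates k + 1 and l + 1. *)
  exists K.+1 => -[//|k] [//|l] Kk Kl y x.
  have eps0' := ltW eps0.
  rewrite -(@ler_pXn2r _ 2)// real_normK ?num_real//.
  apply: (le_trans (diff k l x y)); rewrite -/M.
  have Cn n : (K <= n)%N -> C n.*2.+1 <= L + eta.
    by move=> Kn; apply: HK; rewrite leqW// (leq_trans Kn)// -addnn leq_addr.
  apply: (cauchy_defect_le M0 (ltW eta0) (Cn _ Kk) (Cn _ Kl) (CL _)).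
  by rewrite divfK// gt_eqF// mulr_gt0// ltr_wpDl.
have quarter : 0 < 4^-1 :> R by rewrite invr_gt0.
have [K0 HK0] := unif _ quarter.
(* The diagonal values have mean C K0 >= 1, so one exceeds 1/2; two uniform errors of 1/4 then leave
   the limit column positive at y. *)
have [y [Dy ay]] : exists y, D y /\ 2^-1 < a r K0 y y.
  apply: contrapT => /forallNP ny.
  have : C K0 <= 2^-1.
    rewrite /C mulrC -(meanZ mD muD); last exact: kern_diag_bdm.
    apply: (mean_le_cst mD muD) => [|z Dz].
      by apply: bdmZ; exact: kern_diag_bdm.
    rewrite mulrC leNgt; apply/negP => za.
    by apply: (ny z).
  by have := C1 K0; lra.
have [g bg ug] := bdm_unif_lim (ba^~ y) (fun eps eps0 =>
  let: ex_intro K HK := unif eps eps0 in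
  ex_intro _ K (fun k l Kk Kl => HK k l Kk Kl y)).
have gy : g y != 0.
  have [K HK] := ug _ quarter.
  have := HK (maxn K K0) (leq_maxl _ _) y.
  have := HK0 (maxn K K0) K0 (leq_maxr _ _) (leqnn _) y y.
  rewrite !ler_norml => /andP[? _] /andP[? ?].
  by rewrite gt_eqF//; lra.
have B0 : 0 <= B by exact: le_trans (normr_ge0 _) (SB (y, y)).
have kop_small h eps x : bdm h -> (forall z, `|h z| <= eps) ->
    `|kop h x| <= B * eps.
  move=> bh heps; apply: (norm_mean_le mD muD).
    by have b := bdm_pair1 x bS; exact: bdmM.
  by move=> z _; rewrite normrM ler_pM.
have bkg := kop_bdm bg.
have kkg x : kop (kop g) x = r * g x.
  (* Passage to the limit in S^2 a_K = r a_{K+1}; the errors of the two sides are proportional to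
     B^2 and r, whence [c1]. *)
  apply/eqP; rewrite -subr_eq0 -normr_le0; apply/ler_addgt0Pl => eps eps0.
  rewrite addr0; pose c1 := B ^+ 2 + r.
  have c10 : 0 < c1 by rewrite ltr_wpDl// sqr_ge0.
  have e1 : 0 < eps / c1 by rewrite divr_gt0.
  have [K HK] := ug _ e1.
  have aK := HK K (leqnn _); have aK1 := HK K.+1 (leqnSn _).
  have bk1 : bdm (kop (a r K y)) by exact: kop_bdm.
  have kk : kop (kop (a r K y)) x = r * a r K.+1 y x.
    rewrite (aS K y x r0') mulrA mulfV// mul1r; congr (kop _ x).
    by apply/funext => z; rewrite (kop_a r K y z) (kop_a r K z y) !kcolE kern_sym.
  have s1 : `|kop (kop (fun z => a r K y z - g z)) x| <= B * (B * (eps / c1)).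
    apply: (kop_small); first by apply: kop_bdm; exact: bdmB.
    by move=> z; apply: (kop_small) => //; exact: bdmB.
  have kE : kop (kop (fun z => a r K y z - g z)) x =
      r * a r K.+1 y x - kop (kop g) x.
    rewrite -kk -kopB//; congr (kop _ x); apply/funext => z.
    exact: kopB.
  have -> : kop (kop g) x - r * g x =
      r * (a r K.+1 y x - g x) - kop (kop (fun z => a r K y z - g z)) x.
    by rewrite kE; ring.
  rewrite (le_trans (ler_normB _ _))// normrM (gtr0_norm r0).
  have -> : eps = r * (eps / c1) + B * (B * (eps / c1)).
    by rewrite mulrA -mulrDl addrC /c1 expr2 mulrC divfK// gt_eqF.
  by rewrite lerD// ler_pM2l.
pose s := Num.sqrt r.
have s0 : 0 < s by rewrite sqrtr_gt0.
have ss : s * s = r by rewrite -expr2 sqr_sqrtr// ltW.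
have ds : delta < s.
  by rewrite -(ger0_norm delta0) -sqrtr_sqr ltr_sqrt// (lt_le_trans dc).
(* Since (S - s)(S + s) g = 0, either (S + s) g is an eigenfunction for s or g is one for -s. *)
have [[x hx]|nex] := pselect (exists x, kop g x + s * g x != 0).
  exists s, (fun x => kop g x + s * g x); split=> [|||z].
  - by rewrite gtr0_norm.
  - by apply: bdmD => //; exact: bdmZ.
  - by exists x.
  - by rewrite kopD//; [rewrite kkg kopZ// -ss; ring|exact: bdmZ].
exists (- s), g; split=> [|||z].
- by rewrite normrN gtr0_norm.
- by [].
- by exists y.
- apply/eqP; rewrite mulNr -addr_eq0; apply/negPn/negP => hz.
  by apply: nex; exists z.
Qed.

End TopEigenvalue.

Transparent khs kern kcol ktrace kop kopn.

(** * Removing finitely many eigenfunctions *)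

Section Deflation.
Context d (T : measurableType d) (R : realType).
Variables (mu : {sigma_finite_measure set T -> \bar R}) (D : set T).
Hypotheses (mD : measurable D) (muD : (mu : {measure set T -> \bar R}) D = 1%:E).
Variable K : T * T -> R.
Hypotheses (bK : bdm K) (symK : forall x y, K (x, y) = K (y, x)).
Implicit Types f g u : T -> R.

Local Notation dot := (scal mu D).
Local Notation kop := (kop mu D).

Variables (I : eqType) (r : seq I) (nu : I -> R) (phi : I -> T -> R).
Hypotheses (ur : uniq r) (bphi : forall i, i \in r -> bdm (phi i)).
Hypothesis ortho : {in r &, forall i j, dot (phi i) (phi j) = (i == j)%:R}.
Hypothesis eigen : forall i, i \in r -> forall x, kop K (phi i) x = nu i * phi i x.

(** Bessel's inequality for the row K(x, .), whose coefficients are nu_i phi_i(x), integrated over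
    x. *)
Lemma sum_sqr_eigenvalues B : (forall z, `|K z| <= B) ->
  \sum_(i <- r) nu i ^+ 2 <= B ^+ 2.
Proof.
move=> KB.
have bsq i : i \in r -> bdm (fun x => nu i ^+ 2 * (phi i x * phi i x)).
  by move=> ir; apply: bdmZ; apply: bdmM; exact: bphi.
have -> : \sum_(i <- r) nu i ^+ 2 =
    \int[mu]_(x in D) (\sum_(i <- r) nu i ^+ 2 * (phi i x * phi i x)).
  rewrite (mean_sum mD muD)//; apply: eq_big_seq => i ir.
  rewrite (meanZ mD muD); last by apply: bdmM; exact: bphi.
  by rewrite -/(scal mu D _ _) ortho// eqxx mulr1.
apply: (mean_le_cst mD muD) => [|x _]; first exact: bdm_sum.
have bKx := bdm_pair1 x bK.
have := bessel mD muD bKx bphi ur ortho.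
rewrite (eq_big_seq (fun i => nu i ^+ 2 * (phi i x * phi i x))); last first.
  move=> i ir; have -> : dot (fun y => K (x, y)) (phi i) = nu i * phi i x.
    by rewrite -eigen.
  by rewrite exprMn [X in _ * X]expr2.
move/le_trans; apply; apply: (mean_le_cst mD muD) => [|y _]; first exact: bdmM.
have B0 : 0 <= B by exact: le_trans (normr_ge0 _) (KB (x, y)).
by rewrite -expr2 -[leLHS]real_normK ?num_real// lerXn2r// nnegrE.
Qed.

(** The deflated kernel S annihilates every phi_i, so by symmetry its eigenfunctions with nonzero
    eigenvalue are orthogonal to all of them. [eigenvalue_above] would produce such a function if
    the form were too large. *)
Lemma deflated_form_le f delta : bdm f -> 0 <= delta ->
  (forall l g, delta < `|l| -> bdm g -> (forall x, kop K g x = l * g x) ->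
     (forall i, i \in r -> dot g (phi i) = 0) -> forall x, g x = 0) ->
  `|dot f (kop K f) - \sum_(i <- r) nu i * dot f (phi i) ^+ 2| <= delta * dot f f.
Proof.
move=> bf delta0 complete.
pose P z := \sum_(i <- r) nu i * (phi i z.1 * phi i z.2).
pose S z := K z - P z.
have bPi i : i \in r -> bdm (fun z : T * T => nu i * (phi i z.1 * phi i z.2)).
  move=> ir; apply: bdmZ; apply: bdmM; first exact: bdm_fst (bphi ir).
  exact: bdm_snd (bphi ir).
have bP : bdm P by exact: bdm_sum.
have bS : bdm S by exact: bdmB.
have symS x y : S (x, y) = S (y, x).
  rewrite /S symK; congr (_ - _); apply: eq_bigr => i _ /=.
  by rewrite [phi i x * _]mulrC.
have kopS g x : bdm g ->
    kop S g x = kop K g x - \sum_(i <- r) nu i * dot g (phi i) * phi i x.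
  move=> bg.
  have -> : \sum_(i <- r) nu i * dot g (phi i) * phi i x =
      dot g (fun y => \sum_(i <- r) nu i * phi i x * phi i y).
    rewrite (scal_sumr mD muD)//; last by move=> i ir; apply: bdmZ; exact: bphi.
    apply: eq_big_seq => i ir; rewrite (scalZr mD muD)//; last exact: bphi.
    by rewrite mulrAC.
  have bs : bdm (fun y => \sum_(i <- r) nu i * phi i x * phi i y).
    by apply: bdm_sum => i ir; apply: bdmZ; exact: bphi.
  have bKx := bdm_pair1 x bK.
  rewrite /kop /scal -(meanB mD muD); [|exact: bdmM..].
  apply: mean_ext => y _; rewrite mulrBl; congr (_ - _).
  rewrite mulrC; congr (_ * _); apply: eq_bigr => i _ /=.
  by rewrite mulrA.
have bkf : bdm (kop K f) by exact: kop_bdm.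
have dfS : dot f (kop S f) =
    dot f (kop K f) - \sum_(i <- r) nu i * dot f (phi i) ^+ 2.
  have bs : bdm (fun x => \sum_(i <- r) nu i * dot f (phi i) * phi i x).
    by apply: bdm_sum => i ir; apply: bdmZ; exact: bphi.
  have -> : \sum_(i <- r) nu i * dot f (phi i) ^+ 2 =
      dot f (fun x => \sum_(i <- r) nu i * dot f (phi i) * phi i x).
    rewrite (scal_sumr mD muD)//; last by move=> i ir; apply: bdmZ; exact: bphi.
    apply: eq_big_seq => i ir; rewrite (scalZr mD muD)//; last exact: bphi.
    by rewrite -mulrA.
  rewrite /scal -(meanB mD muD); [|exact: bdmM..].
  by apply: mean_ext => x _; rewrite kopS// mulrBr.
rewrite -dfS leNgt; apply/negP => lt.
have [l [g [dl bg [x0 gx0] gl]]] := eigenvalue_above mD muD bS symS bf delta0 lt.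
have l0 : l != 0 by rewrite -normr_gt0 (le_lt_trans delta0).
have Sphi j : j \in r -> forall x, kop S (phi j) x = 0.
  move=> jr x; rewrite kopS ?eigen//; last exact: bphi.
  rewrite (bigD1_seq j)//= ortho// eqxx mulr1 big1_seq ?addr0 ?subrr//.
  by move=> i /andP[ij ir]; rewrite ortho// eq_sym (negbTE ij) mulr0 mul0r.
have gphi i : i \in r -> dot g (phi i) = 0.
  move=> ir; apply/eqP; rewrite -(mulrI_eq0 _ (mulfI l0)).
  rewrite scalC -(scalZr mD muD)//; last exact: bphi.
  have -> : (fun x => l * g x) = kop S g by apply/funext => x; rewrite gl.
  rewrite scalC (kop_sym mD muD bS symS)//; last exact: bphi.
  rewrite -[X in _ == X](mean_cst mD muD (0 : R)); apply/eqP.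
  by apply: mean_ext => x _; rewrite Sphi// mulr0.
(* On such a g the removed sum vanishes, so g is also an eigenfunction of K for l. *)
move: gx0; rewrite (complete l g)// ?eqxx// => x.
rewrite -gl kopS// big1_seq ?subr0// => i /andP[_ ir].
by rewrite gphi// mulr0 mul0r.
Qed.

(* The samples [s i] are compared with [N * dot alpha (phi i)] through [F] and
   [N * kop K alpha], whose coefficients are [nu i] times these quantities. *)
Lemma sampled_form_le alpha F H (N delta : R) (s : I -> R) :
  bdm alpha -> bdm F -> dot alpha alpha <= 1 -> 0 < delta ->
  (forall i, i \in r -> delta < `|nu i|) ->
  (forall i, i \in r -> nu i * s i = dot F (phi i)) ->
  (forall x, H x = F x - N * kop K alpha x) ->
  `|\sum_(i <- r) nu i * s i ^+ 2 -
    \sum_(i <- r) nu i * (N * dot alpha (phi i)) ^+ 2| <=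
  2 * dot H H / delta + delta * N ^+ 2.
Proof.
move=> balpha bF alpha1 delta0 nudelta sF HE.
have bka : bdm (kop K alpha) by exact: kop_bdm.
have bH : bdm H.
  by rewrite (funext HE); apply: bdmB => //; exact: bdmZ.
have Hphi i : i \in r -> dot H (phi i) = nu i * (s i - N * dot alpha (phi i)).
  move=> ir; have bi := bphi ir.
  have -> : dot H (phi i) = dot F (phi i) - N * dot (kop K alpha) (phi i).
    rewrite /scal -(meanZ mD muD); last exact: bdmM.
    rewrite -(meanB mD muD); [|exact: bdmM|by apply: bdmZ; exact: bdmM].
    by apply: mean_ext => x _; rewrite HE mulrBl mulrA.
  rewrite -sF// (kop_sym mD muD bK symK)//.
  have -> : dot alpha (kop K (phi i)) = nu i * dot alpha (phi i).
    by rewrite -(scalZr mD muD)//; apply: mean_ext => x _; rewrite eigen.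
  ring.
rewrite -sumrB (le_trans (ler_norm_sum _ _ _))//.
apply: (@le_trans _ _ (\sum_(i <- r) (2 / delta * dot H (phi i) ^+ 2 +
    delta * N ^+ 2 * dot alpha (phi i) ^+ 2))).
  rewrite big_seq [leRHS]big_seq; apply: ler_sum => i ir.
  rewrite Hphi//; set A := dot alpha _.
  have n0 : 0 < `|nu i| by rewrite (lt_trans delta0)// nudelta.
  (* Only nu_i t, with t the deviation of the sample, is controlled. The term nu_i t^2 costs a
     factor 1/delta because delta < |nu_i|; the mixed term is split by the arithmetic-geometric
     inequality with weight delta. *)
  have -> : nu i * s i ^+ 2 - nu i * (N * A) ^+ 2 =
    nu i * (s i - N * A) * (s i - N * A) + 2 * (N * A) * (nu i * (s i - N * A)).
    ring.
  set t := s i - N * A.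
  have h1 : `|nu i * t * t| <= delta^-1 * (nu i * t) ^+ 2.
    rewrite ler_pdivlMl// -mulrA !normrM exprMn -(real_normK (num_real (nu i))).
    rewrite -(real_normK (num_real t)) -expr2 mulrA expr2.
    by apply: ler_wpM2r; rewrite ?sqr_ge0// ler_wpM2r// ltW// nudelta.
  have h2 : `|2 * (N * A) * (nu i * t)| <=
      delta * (N * A) ^+ 2 + delta^-1 * (nu i * t) ^+ 2.
    set a := N * A; set b := nu i * t.
    have e1 : delta^-1 * delta = 1 by rewrite mulVf// gt_eqF.
    have di0 : 0 < delta^-1 by rewrite invr_gt0.
    have p1 : 0 <= delta^-1 * (delta * a - b) ^+ 2 by rewrite mulr_ge0 ?sqr_ge0// ltW.
    have p2 : 0 <= delta^-1 * (delta * a + b) ^+ 2 by rewrite mulr_ge0 ?sqr_ge0// ltW.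
    have q1 : delta^-1 * (delta * a - b) ^+ 2 =
      delta * a ^+ 2 + delta^-1 * b ^+ 2 - 2 * a * b.
      by field; rewrite gt_eqF.
    have q2 : delta^-1 * (delta * a + b) ^+ 2 =
      delta * a ^+ 2 + delta^-1 * b ^+ 2 + 2 * a * b.
      by field; rewrite gt_eqF.
    by rewrite ler_norml; apply/andP; split; lra.
  rewrite (le_trans (ler_normD _ _))//.
  have -> : 2 / delta * (nu i * t) ^+ 2 + delta * N ^+ 2 * A ^+ 2 =
    delta^-1 * (nu i * t) ^+ 2 + (delta * (N * A) ^+ 2 + delta^-1 * (nu i * t) ^+ 2).
    ring.
  exact: lerD.
rewrite big_split/= -!mulr_sumr [X in _ <= X + _]mulrAC; apply: lerD.
  apply: ler_wpM2l; first by rewrite divr_ge0// ltW.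
  exact: (bessel mD muD bH bphi ur ortho).
rewrite -[leRHS]mulr1; apply: ler_wpM2l; first by rewrite mulr_ge0 ?sqr_ge0// ltW.
exact: le_trans (bessel mD muD balpha bphi ur ortho) alpha1.
Qed.

End Deflation.

(** * The Moebius function *)

(** The factor p either repeats, which creates a square, or adds one prime and flips the sign. *)
Lemma mobius_primeM p e : prime p -> (0 < e)%N ->
  mobius (p * e) = if (p %| e)%N then 0 else - mobius e.
Proof.
move=> pp e0; have p0 := prime_gt0 pp.
have pe0 : (0 < p * e)%N by rewrite muln_gt0 p0.
have loge q : logn q (p * e) = ((q == p) + logn q e)%N.
  by rewrite lognM// logn_prime.
have mempe q : (q \in primes (p * e)) = (q == p) || (q \in primes e).
  by rewrite primesM// primes_prime// inE.
case: ifP => [pe|/negbT pe].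
  rewrite /mobius /squarefree pe0/=; case: allP => // /(_ p).
  rewrite mempe eqxx loge eqxx => /(_ isT).
  by rewrite -[1%N]addn0 eqn_add2l -leqn0 leqNgt logn_gt0 mem_primes pp e0 pe.
have pne : p \notin primes e by rewrite mem_primes pp e0.
have perm : perm_eq (primes (p * e)) (p :: primes e).
  by apply: uniq_perm; rewrite /= ?pne ?primes_uniq// => q; rewrite mempe inE.
rewrite /mobius (perm_size perm) /= exprS mulN1r.
suff -> : squarefree (p * e) = squarefree e by case: ifP; rewrite ?oppr0.
rewrite /squarefree pe0 e0 (perm_all _ perm)/= loge eqxx.
have /eqP -> : logn p e == 0%N by rewrite -leqn0 leqNgt logn_gt0.
apply: eq_in_all => q qe; rewrite loge.
by case: (q =P p) => [qp|//]; move: qe pne; rewrite qp => ->.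
Qed.

(** For a prime p dividing n, the divisors p e cancel against the divisors e not divisible by p, the
    other e contributing 0. *)
Lemma sum_mobius_divisors n : (0 < n)%N ->
  \sum_(d <- divisors n) mobius d = (n == 1)%N%:R.
Proof.
move=> n0; have [->|n1] := eqVneq n 1%N; first by rewrite big_seq1.
have pp : prime (pdiv n) by rewrite pdiv_prime// ltn_neqAle eq_sym n1.
set p := pdiv n in pp; have p0 := prime_gt0 pp.
have pn : (p %| n)%N by exact: pdiv_dvd.
rewrite (bigID (fun d => p %| d)%N)/=.
have -> : \sum_(d <- divisors n | (p %| d)%N) mobius d =
    \sum_(e <- divisors n | (p * e %| n)%N) mobius (p * e).
  rewrite -big_filter -[RHS]big_filter -[RHS](big_map (muln p) predT mobius).
  apply: perm_big; apply: uniq_perm.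
  - by rewrite filter_uniq// divisors_uniq.
  - rewrite map_inj_uniq ?filter_uniq ?divisors_uniq// => a b /eqP.
    by rewrite eqn_pmul2l// => /eqP.
  move=> d; rewrite mem_filter -dvdn_divisors//; apply/andP/mapP.
    move=> [/dvdnP[e ->] en]; exists e; last by rewrite mulnC.
    rewrite mem_filter mulnC en -dvdn_divisors//.
    by rewrite (dvdn_trans _ en)// dvdn_mulr.
  by move=> [e]; rewrite mem_filter => /andP[pen _] ->; rewrite dvdn_mulr.
have -> : \sum_(e <- divisors n | (p * e %| n)%N) mobius (p * e) =
    \sum_(e <- divisors n | ~~ (p %| e)%N) - mobius e.
  rewrite big_mkcond [RHS]big_mkcond; apply: eq_big_seq => e.
  rewrite -dvdn_divisors// => en.
  have e0 : (0 < e)%N by exact: dvdn_gt0 en.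
  rewrite mobius_primeM//; case: (boolP (p %| e)%N) => pe/=; first by case: ifP.
  by rewrite Gauss_dvd ?pn ?en// prime_coprime.
by rewrite sumrN addNr.
Qed.

(** [Y %/ n] counts the multiples of n up to Y; exchanging the sums leaves divisor sums of the
    Moebius function. Letting X exceed Y allows one range for all rows in [meissel_identity]. *)
Lemma sum_mobius_div X Y : (0 < Y <= X)%N ->
  \sum_(1 <= n < X.+1) mobius n * (Y %/ n)%:Z = 1.
Proof.
move=> /andP[Y0 YX].
have -> : \sum_(1 <= n < X.+1) mobius n * (Y %/ n)%:Z =
    \sum_(1 <= k < Y.+1) \sum_(1 <= n < X.+1)
      if (n %| k)%N then mobius n else 0.
  rewrite [RHS]exchange_big_nat/=; apply: eq_bigr => n _.
  rewrite divn_count_dvd -natz natr_sum mulr_sumr.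
  by apply: eq_bigr => k _; case: (n %| k)%N; rewrite ?mulr1 ?mulr0.
rewrite (eq_big_nat _ _ (F2 := fun k => (k == 1)%N%:R)); last first.
  move=> k /andP[k0 kY]; rewrite -sum_mobius_divisors// -big_mkcond -big_filter.
  apply: perm_big; apply: uniq_perm; rewrite ?divisors_uniq ?filter_uniq ?iota_uniq//.
  move=> n; rewrite mem_filter mem_index_iota -dvdn_divisors//.
  case: (boolP (n %| k)%N) => //= nk; rewrite (dvdn_gt0 k0 nk) ltnS.
  by rewrite (leq_trans (dvdn_leq k0 nk))// (leq_trans _ YX).
rewrite big_ltn// eqxx big_nat big1 ?addr0// => k /andP[k2 _].
by rewrite gtn_eqF.
Qed.

(** The array a is symmetric, its row m sums to mu(m), and it vanishes when m and n both exceed N.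
    So M(N^2) is M(N) plus an off-diagonal block, while M(N) is the square block plus the same
    off-diagonal block. *)
Lemma meissel_identity N : (0 < N)%N ->
  \sum_(1 <= n < (N ^ 2).+1) mobius n = 2 * \sum_(1 <= n < N.+1) mobius n -
  \sum_(1 <= m < N.+1) \sum_(1 <= n < N.+1)
    mobius m * mobius n * (N ^ 2 %/ (m * n))%:Z.
Proof.
move=> N0; set X := (N ^ 2)%N.
have NX : (N.+1 <= X.+1)%N by rewrite ltnS /X -mulnn leq_pmulr.
pose a m n := mobius m * mobius n * (X %/ (m * n))%:Z.
have aC m n : a m n = a n m by rewrite /a [mobius m * _]mulrC mulnC.
have rowsum m : (1 <= m < X.+1)%N -> \sum_(1 <= n < X.+1) a m n = mobius m.
  move=> /andP[m0 mX]; rewrite -[RHS]mulr1 -(@sum_mobius_div X (X %/ m)).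
    by rewrite mulr_sumr; apply: eq_bigr => n _; rewrite /a divnMA mulrA.
  by rewrite divn_gt0// -ltnS mX leq_div.
have bigcat (F : nat -> int) : \sum_(1 <= n < X.+1) F n =
    \sum_(1 <= n < N.+1) F n + \sum_(N.+1 <= n < X.+1) F n.
  by rewrite -big_cat_nat.
have small m n : (N < m)%N -> (N < n)%N -> a m n = 0.
  by move=> Nm Nn; rewrite /a divn_small ?mulr0// /X -mulnn ltn_mul.
have small_sum m : (N < m)%N ->
    \sum_(1 <= n < X.+1) a m n = \sum_(1 <= n < N.+1) a m n.
  move=> Nm; rewrite bigcat [X in _ + X]big_nat [X in _ + X]big1 ?addr0//.
  move=> n /andP[Nn _].
  exact: small.
have E1 : \sum_(1 <= n < X.+1) mobius n = \sum_(1 <= m < N.+1) mobius m +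
    \sum_(N.+1 <= m < X.+1) \sum_(1 <= n < N.+1) a m n.
  rewrite bigcat; congr (_ + _); apply: eq_big_nat => m /andP[Nm mX].
  by rewrite -small_sum// rowsum// mX andbT (leq_trans _ Nm).
have E2 : \sum_(1 <= m < N.+1) mobius m =
    \sum_(1 <= m < N.+1) \sum_(1 <= n < N.+1) a m n +
    \sum_(N.+1 <= m < X.+1) \sum_(1 <= n < N.+1) a m n.
  rewrite [X in _ = _ + X]exchange_big_nat/= -big_split/=.
  apply: eq_big_nat => m /andP[m0 mN].
  rewrite -(rowsum m) ?m0 ?(leq_trans mN)// bigcat; congr (_ + _).
  by apply: eq_bigr => n _; rewrite aC.
rewrite E1 -/a; lra.
Qed.

(** * Oscillation of the kernel *)

Section KernelBounds.
Context {R : realType}.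
Implicit Types x y u v : R.

Lemma frac_itv u : 0 <= Defs.frac u < 1.
Proof. by rewrite /Defs.frac subr_ge0 floor_le ltrBlDr addrC -intrD1 floorD1_gt. Qed.

Lemma kerKC x y : kerK x y = kerK y x.
Proof. by rewrite /kerK andbC [x * y]mulrC. Qed.

Lemma kerK_le x y : `|kerK x y| <= 2^-1.
Proof.
rewrite /kerK; case: ifP => _; last by rewrite normr0 invr_ge0.
by have /andP[f0 f1] := frac_itv (1 / (x * y)); rewrite ler_norml; lra.
Qed.

Lemma kerK_gt0 x y : 0 < x -> 0 < y -> kerK x y = 2^-1 - Defs.frac (x * y)^-1.
Proof. by move=> x0 y0; rewrite /kerK x0 y0 div1r. Qed.

Lemma bdm_kerK : bdm (fun z : R * R => kerK z.1 z.2).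
Proof.
split; last by exists 2^-1 => z; exact: kerK_le.
have m1 := @measurable_fst _ _ R R; have m2 := @measurable_snd _ _ R R.
have mpos (f : R * R -> R) : measurable_fun setT f ->
    measurable_fun setT (fun z => 0 < f z).
  by move=> mf; apply: measurable_fun_ltr.
have mfloor : measurable_fun setT (fun u : R => (Num.floor u)%:~R : R).
  by apply: nondecreasing_measurable => // u v uv; rewrite ler_int le_floor.
(* On positive numbers the inverse is the real power of exponent -1, a measurable function. *)
have -> : (fun z : R * R => kerK z.1 z.2) = (fun z =>
    if (0 < z.1) && (0 < z.2) then 2^-1 - Defs.frac ((z.1 * z.2) `^ (-1)) else 0).
  apply/funext => z; rewrite /kerK; case: ifP => // /andP[x0 y0].
  by rewrite powR_inv1 ?div1r// ltW// mulr_gt0.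
apply: measurable_fun_ifT => //.
  by apply: measurable_and; exact: mpos.
apply: measurable_funB => //.
have mp : measurable_fun setT (fun z : R * R => (z.1 * z.2) `^ (-1)).
  apply: (measurableT_comp (measurable_powR (-1))); exact: measurable_funM.
by apply: measurable_funB => //; exact: measurableT_comp mfloor mp.
Qed.

Lemma frac_diff_le1 u v : `|(2^-1 - Defs.frac u) - (2^-1 - Defs.frac v)| <= 1.
Proof.
have /andP[u0 u1] := frac_itv u; have /andP[v0 v1] := frac_itv v.
by rewrite ler_norml; lra.
Qed.

(** The fractional part is a difference of two nondecreasing functions; its increments are bounded
    by those of their sum, which telescope. *)
Lemma frac_diff_le u v : v <= u ->
  `|(2^-1 - Defs.frac v) - (2^-1 - Defs.frac u)| <=
  (u + (Num.floor u)%:~R) - (v + (Num.floor v)%:~R).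
Proof.
move=> vu; have : (Num.floor v)%:~R <= (Num.floor u)%:~R :> R.
  by rewrite ler_int le_floor.
by rewrite /Defs.frac ler_norml; lra.
Qed.

End KernelBounds.

(** Induction from ln (1 - 1/m) <= - 1/m. *)
Lemma harmonic_le (R : realType) n : (0 < n)%N ->
  \sum_(1 <= k < n.+1) k%:R^-1 <= 1 + ln n%:R :> R.
Proof.
elim: n => // -[|n] IH _; first by rewrite big_nat1 ln1 invr1 addr0.
rewrite big_nat_recr//= (le_trans (lerD (IH isT) (lexx _)))// -addrA lerD2l.
have n10 : 0 < n.+1%:R :> R by [].
have n20 : 0 < n.+2%:R :> R by [].
have E : n.+1%:R = n.+2%:R * (1 + - n.+2%:R^-1) :> R.
  by rewrite mulrDr mulrN mulfV// mulr1 -[n.+2%:R]natr1 addrK.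
have p : 0 < 1 + - n.+2%:R^-1 :> R by rewrite subr_gt0 invf_lt1// ltr1n.
have lnE : ln n.+1%:R = ln n.+2%:R + ln (1 + - n.+2%:R^-1) :> R.
  by rewrite -lnM ?posrE// -E.
have : ln (1 + - n.+2%:R^-1) <= - n.+2%:R^-1 :> R.
  by apply: le_ln1Dx; rewrite ltrN2 invf_lt1// ltr1n.
by move=> lnp; rewrite lnE -addrA gerDl -lerBrDr sub0r.
Qed.

(* The Lebesgue measure packed with its sigma-finite structure, so that the
   general lemmas unify with it. *)
Definition lebR (R : realType) :
  {sigma_finite_measure set (measurableTypeR R) -> \bar R} := @lebesgue_measure R.

(** * Cells of the grid and variation of the kernel over them *)

Section Grid.
Context {R : realType}.
Variable N : nat.
Hypothesis N0 : (0 < N)%N.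

Local Notation mu := (lebR R).
Local Notation D := (@I01 R).
Local Notation E f := (\int[mu]_(x in D) f x).
Local Notation dot := (scal mu D).
Local Notation NR := (N%:R : R).

Let NR0 : 0 < NR. Proof. by rewrite ltr0n. Qed.

Lemma measurable_I01 : measurable (D : set (measurableTypeR R)).
Proof. exact: measurable_itv. Qed.

Lemma lebesgue_I01 : (mu : {measure set _ -> \bar R}) D = 1%:E.
Proof.
rewrite /lebR/I01/= lebesgue_measure_itv/= lte_fin ltr01 oppr0 adde0//.
Qed.

Let mD := measurable_I01.
Let muD := lebesgue_I01.

Definition kK (z : R * R) : R := kerK z.1 z.2.

(** Open on the left and closed on the right: the cells 1 to N partition ]0, 1], n/N lies in cell n,
    and 0 lies in none of them. *)
Definition cell (n : nat) (x : R) : R := (n.-1%:R < NR * x <= n%:R)%R%:R.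

Lemma cell_set n : (cell n : R -> R) =
  \1_[set` Interval (BRight (n.-1%:R / NR)) (BRight (n%:R / NR))].
Proof.
apply/funext => x; rewrite /cell indicE; congr (nat_of_bool _)%:R.
by rewrite mem_setE in_itv/= ltr_pdivrMr// ler_pdivlMr// [x * _]mulrC.
Qed.

Lemma bdm_cell n : bdm (cell n).
Proof.
split; last by exists 1 => x; rewrite /cell; case: (_ && _); rewrite ?normr1 ?normr0.
rewrite cell_set; apply: measurable_indic; exact: measurable_itv.
Qed.

Lemma mean_cell n : (0 < n <= N)%N -> E (cell n) = NR^-1.
Proof.
move=> /andP[n0 nN]; rewrite cell_set /Rintegral.
rewrite integral_indic; [|exact: mD|exact: measurable_itv].
rewrite setIidl; last first.
  move=> x /=; rewrite /I01/= !in_itv/= => /andP[x0 x1]; apply/andP; split.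
    by apply: le_trans (ltW x0); rewrite divr_ge0.
  by rewrite (le_trans x1)// ler_pdivrMr// mul1r ler_nat.
rewrite /lebR/= lebesgue_measure_itv/= lte_fin ltr_pM2r ?invr_gt0// ltr_nat.
rewrite prednK// leqnn -EFinB/= -mulrBl.
by rewrite -{1}(prednK n0) -[n.-1.+1%:R]natr1 addrAC subrr add0r mul1r.
Qed.

Lemma sum_cell x : \sum_(1 <= n < N.+1) cell n x = (0 < NR * x <= NR)%R%:R.
Proof.
have cellE n : (0 < n)%N -> cell n x = (NR * x <= n%:R)%R%:R - (NR * x <= n.-1%:R)%R%:R.
  move=> n0; rewrite /cell [_ < _]ltNge.
  have : n.-1%:R <= n%:R :> R by rewrite ler_nat leq_pred.
  case: (leP (NR * x) n.-1%:R) => [h1 h2|_ _].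
    by rewrite (le_trans h1 h2) subrr.
  by rewrite subr0.
rewrite (eq_big_nat _ _
  (F2 := fun n => (NR * x <= n%:R)%R%:R - (NR * x <= n.-1%:R)%R%:R)); last first.
  by move=> n /andP[n0 _]; exact: cellE.
rewrite big_add1/= (telescope_sumr (fun n => (NR * x <= n%:R)%R%:R))//.
rewrite [0 < _]ltNge; case: (leP (NR * x) 0%:R) => [h|_].
  by rewrite (le_trans h)// subrr.
by rewrite subr0.
Qed.

(* The kernel oscillates by at most 1 on a cell, and, away from the first [k]
   cells, by at most the variation of [u + floor u] for [u = N / (n x)], which
   telescopes. *)
Lemma kerK_osc x : 0 < x <= 1 -> exists b : nat -> R,
  [/\ forall n y, (0 < n <= N)%N -> n.-1%:R < NR * y <= n%:R ->
        `|kerK (n%:R / NR) x - kerK y x| <= b n,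
      0 <= \sum_(1 <= n < N.+1) b n &
      (\sum_(1 <= n < N.+1) b n) ^+ 2 <= 16 * (NR / x)].
Proof.
move=> /andP[x0 x1].
have nR n : (0 < n)%N -> 0 < n%:R / NR by move=> n0; rewrite divr_gt0// ltr0n.
have yR n y : n.-1%:R < NR * y -> 0 < y.
  by move=> h; rewrite -(pmulr_rgt0 _ NR0) (le_lt_trans _ h).
have osc1 n y : (0 < n)%N -> n.-1%:R < NR * y ->
    `|kerK (n%:R / NR) x - kerK y x| <= 1.
  by move=> n0 h; rewrite !kerK_gt0// ?nR ?(yR n)//; exact: frac_diff_le1.
pose u n : R := NR / (n%:R * x).
pose g n : R := u n + (Num.floor (u n))%:~R.
have u0 n : 0 <= u n by rewrite divr_ge0 ?mulr_ge0// ltW.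
have umono m n : (0 < m <= n)%N -> u n <= u m.
  move=> /andP[m0 mn]; rewrite ler_pM2l// lef_pV2 ?posrE ?mulr_gt0 ?ltr0n//.
    by rewrite ler_pM2r// ler_nat.
  exact: leq_trans mn.
have gmono m n : (0 < m <= n)%N -> g n <= g m.
  by move=> mn; rewrite lerD ?umono// ler_int le_floor// umono.
have osc n y : (1 < n)%N -> n.-1%:R < NR * y <= n%:R ->
    `|kerK (n%:R / NR) x - kerK y x| <= g n.-1 - g n.
  move=> n1 /andP[h1 h2]; have n0 : (0 < n)%N by exact: ltnW.
  have y0 := yR _ _ h1; have n10 : (0 < n.-1)%N by rewrite -ltnS prednK.
  rewrite !kerK_gt0// ?nR//.
  have e1 : (n%:R / NR * x)^-1 = u n.
    by rewrite /u; field; rewrite !gt_eqF ?ltr0n.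
  have yx0 : 0 < y * x by exact: mulr_gt0.
  have nx0 m : (0 < m)%N -> 0 < m%:R / NR * x by move=> m0; rewrite mulr_gt0// nR.
  have le1 : u n <= (y * x)^-1.
    rewrite -e1 lef_pV2 ?posrE ?nx0// ler_pM2r// ler_pdivlMr//.
    by rewrite mulrC.
  have le2 : (y * x)^-1 <= u n.-1.
    have -> : u n.-1 = (n.-1%:R / NR * x)^-1.
      by rewrite /u; field; rewrite !gt_eqF ?ltr0n.
    rewrite lef_pV2 ?posrE ?nx0// ler_pM2r// ler_pdivrMr//.
    by rewrite mulrC ltW.
  rewrite e1 (le_trans (frac_diff_le le1))// lerD2r lerD// ler_int.
  exact: le_floor.
pose b k n := if (n <= k)%N then 1 else g n.-1 - g n.
have b0 k n : (0 < k)%N -> 0 <= b k n.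
  move=> k0; rewrite /b; case: leqP => // kn; rewrite subr_ge0 gmono//.
  by rewrite leq_pred andbT; lia.
have bosc k n y : (0 < k)%N -> (0 < n <= N)%N -> n.-1%:R < NR * y <= n%:R ->
    `|kerK (n%:R / NR) x - kerK y x| <= b k n.
  move=> k0 /andP[n0 nN] h; rewrite /b; case: leqP => kn.
    by apply: osc1 => //; case/andP: h.
  by apply: osc => //; exact: leq_ltn_trans kn.
have sumb k : (0 < k <= N)%N ->
    \sum_(1 <= n < N.+1) b k n = k%:R + (g k - g N).
  move=> /andP[k0 kN]; rewrite (@big_cat_nat _ _ _ k.+1)//=; congr (_ + _).
    rewrite (eq_big_nat _ _ (F2 := fun=> 1)); last first.
      by move=> n /andP[_ nk]; rewrite /b -ltnS nk.
    by rewrite sumr_const_nat subSS subn0.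
  rewrite (eq_big_nat _ _ (F2 := fun n => g n.-1 - g n)); last first.
    by move=> n /andP[kn _]; rewrite /b leqNgt kn.
  rewrite big_add1/= (telescope_sumr_eq (fun i => - g i))//.
    by rewrite opprK addrC.
  by move=> i _; rewrite opprK addrC.
(* Cutting at k close to s balances the k trivial bounds against the remaining variation, at most 2
   N / (k x). *)
pose s := Num.sqrt (NR / x).
have ss : s ^+ 2 = NR / x by rewrite sqr_sqrtr// divr_ge0 ?ltW.
have s1 : 1 <= s.
  rewrite -[leLHS]sqrtr1; apply: ler_wsqrtr; rewrite ler_pdivlMr// mul1r.
  by rewrite (le_trans x1)// ler1n.
have s0 : 0 < s by exact: lt_le_trans s1.
pose k := (Num.truncn s).+1.
have sk : s < k%:R by exact: truncnS_gt.
have ks : k%:R <= s + 1 by rewrite -natr1 lerD2r truncn_le ltW.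
(* If the cut falls beyond N, the trivial bound on all cells suffices, as N <= s. *)
have [kN|Nk] := leqP k N; last first.
  exists (b N); split=> [n y||].
  - exact: bosc.
  - by apply: sumr_ge0 => n _; exact: b0.
  - have -> : \sum_(1 <= n < N.+1) b N n = NR.
      by rewrite sumb ?N0 ?leqnn// addrN addr0.
    rewrite -ss.
    have : NR <= s by rewrite -(lerD2r 1) (le_trans _ ks)// natr1 ler_nat.
    by have := NR0; nra.
exists (b k); split=> [n y||].
- exact: bosc.
- by apply: sumr_ge0 => n _; exact: b0.
- have gN : 0 <= g N by rewrite addr_ge0// ler0z floor_ge0.
  have uk : u k <= s.
    rewrite /u invfM mulrA mulrAC -ss ler_pdivrMr ?ltr0n// expr2.
    by rewrite ler_pM2l// ltW.
  have gk : g k <= 2 * s by have := floor_le (u k); rewrite /g; lra.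
  have sb0 : 0 <= \sum_(1 <= n < N.+1) b k n by apply: sumr_ge0 => n _; exact: b0.
  (* k <= s + 1, the variation is at most 2 s, and 1 <= s; squaring 4 s gives the constant 16. *)
  have : \sum_(1 <= n < N.+1) b k n <= 4 * s by rewrite sumb//; lra.
  by rewrite -ss; nra.
Qed.

End Grid.

(** * Sampling on the grid *)

Section Sampling.
Context {R : realType}.
Variable N : nat.
Hypothesis N0 : (0 < N)%N.
Variable c : nat -> R.
Hypothesis c1 : forall n, `|c n| <= 1.

Local Notation mu := (lebR R).
Local Notation D := (@I01 R).
Local Notation E f := (\int[mu]_(x in D) f x).
Local Notation dot := (scal mu D).
Local Notation NR := (N%:R : R).
Local Notation bdmR := (@bdm _ (measurableTypeR R) R).
Local Notation cell := (cell N).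
Local Notation kop := (kop mu D kK).

Let NR0 : 0 < NR. Proof. by rewrite ltr0n. Qed.
Let mD := @measurable_I01 R.
Let muD := @lebesgue_I01 R.
Let bK : bdm (@kK R) := bdm_kerK.
Let bcell n : bdmR (cell n) := bdm_cell N0 n.

Let bker x : bdmR (kerK x).
Proof. exact: (bdm_pair1 x bK). Qed.

(** [c] stands for the Moebius function, through the bound |c n| <= 1. This is the alpha of the
    outline, [sampled] is F, and [defect] is the quadrature error F - N T alpha. *)
Definition step x := \sum_(1 <= n < N.+1) c n * cell n x.

Definition sampled x := \sum_(1 <= n < N.+1) c n * kerK (n%:R / NR) x.

Definition defect x := sampled x - NR * kop step x.

Lemma bdm_step : bdmR step.
Proof. by apply: bdm_sum => n _; exact: bdmZ. Qed.

Lemma bdm_sampled : bdmR sampled.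
Proof. by apply: bdm_sum => n _; exact: bdmZ. Qed.

Lemma bdm_kop_step : bdmR (kop step).
Proof. exact: (@kop_bdm _ _ _ mu _ mD muD _ bK _ bdm_step). Qed.

Lemma bdm_defect : bdmR defect.
Proof. by apply: bdmB bdm_sampled (bdmZ _ bdm_kop_step). Qed.

Let cell_ge0 n (x : R) : 0 <= cell n x.
Proof. by rewrite /cell ler0n. Qed.

Lemma step_norm : dot step step <= 1.
Proof.
rewrite /scal; apply: (mean_le_cst mD muD) => [|x _].
  exact: bdmM bdm_step bdm_step.
have s1 : `|step x| <= 1.
  apply: (@le_trans _ _ (\sum_(1 <= n < N.+1) cell n x)).
    rewrite (le_trans (ler_norm_sum _ _ _))//; apply: ler_sum => n _.
    by rewrite normrM (ger0_norm (cell_ge0 n x)) ler_piMl.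
  by rewrite sum_cell//; case: (_ && _).
by rewrite -expr2 -[leLHS]real_normK ?num_real// expr_le1.
Qed.

(** Cells have length 1/N, so N times an integral over a cell is a mean: the defect collects the
    deviations of K(n/N, x) from the cell means of K(., x). *)
Lemma defectE x : defect x = \sum_(1 <= n < N.+1)
  c n * (NR * E (fun y => (kerK (n%:R / NR) x - kerK y x) * cell n y)).
Proof.
have bky : bdmR (fun y => kerK y x) by exact: (bdm_pair2 x bK).
have kopE : kop step x = \sum_(1 <= n < N.+1) c n * E (fun y => kerK y x * cell n y).
  transitivity (\sum_(1 <= n < N.+1) E (fun y => c n * (kerK y x * cell n y))).
    rewrite -(mean_sum mD muD) => [|n _]; last by apply: bdmZ; exact: bdmM.
    apply: mean_ext => y _; rewrite mulr_sumr; apply: eq_bigr => n _.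
    by rewrite /kK/= kerKC mulrCA.
  by apply: eq_bigr => n _; rewrite (meanZ mD muD)//; exact: bdmM.
rewrite /defect kopE mulr_sumr -sumrB; apply: eq_big_seq => n.
rewrite mem_index_iota ltnS => nN; rewrite mulrCA -mulrBr; congr (_ * _).
have -> : E (fun y => (kerK (n%:R / NR) x - kerK y x) * cell n y) =
    kerK (n%:R / NR) x * NR^-1 - E (fun y => kerK y x * cell n y).
  have -> : kerK (n%:R / NR) x * NR^-1 = E (fun y => kerK (n%:R / NR) x * cell n y).
    by rewrite (meanZ mD muD)// (mean_cell N0 nN).
  rewrite -(meanB mD muD); [|exact: bdmZ|exact: bdmM].
  by apply: mean_ext => y _; rewrite mulrBl.
by rewrite mulrBr mulrCA mulfV ?gt_eqF// mulr1.
Qed.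

Lemma defect_le b x :
  (forall n y, (0 < n <= N)%N -> n.-1%:R < NR * y <= n%:R ->
     `|kerK (n%:R / NR) x - kerK y x| <= b n) ->
  `|defect x| <= \sum_(1 <= n < N.+1) b n.
Proof.
move=> hb; rewrite defectE (le_trans (ler_norm_sum _ _ _))//.
rewrite big_seq [leRHS]big_seq; apply: ler_sum => n.
rewrite mem_index_iota ltnS => nN.
have bky : bdmR (fun y => kerK y x) by exact: (bdm_pair2 x bK).
have bd : bdmR (fun y => (kerK (n%:R / NR) x - kerK y x) * cell n y).
  by apply: bdmM => //; apply: bdmB => //; exact: bdm_cst.
rewrite normrM (le_trans (ler_piMl _ (c1 n)))// normrM gtr0_norm//.
have -> : b n = NR * E (fun y => b n * cell n y).
  by rewrite (meanZ mD muD)// (mean_cell N0 nN) mulrCA mulfV ?mulr1// gt_eqF.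
rewrite ler_pM2l//.
rewrite (le_trans (le_norm_mean mD muD bd))//.
apply: (le_mean mD muD) => [||y _]; [exact: bdm_norm|exact: bdmZ|].
rewrite normrM /cell.
case: (boolP (n.-1%:R < NR * y <= n%:R)) => h; last by rewrite /= normr0 !mulr0.
by rewrite /= normr1 !mulr1 hb.
Qed.

Lemma defect0 : defect 0 = 0.
Proof.
apply/eqP; rewrite -normr_le0.
rewrite (le_trans (defect_le (b := fun=> 0) _))//; last by rewrite big1.
move=> n y _ _; have k0 z : kerK z (0 : R) = 0 by rewrite /kerK ltxx andbF.
by rewrite !k0 subrr normr0.
Qed.

Lemma defect_sqr x : 0 < x <= 1 -> defect x ^+ 2 <= 16 * (NR / x).
Proof.
move=> x01; have [b [hb b0 b2]] := kerK_osc N0 x01.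
apply: le_trans b2; rewrite -real_normK ?num_real// lerXn2r ?nnegrE//.
exact: defect_le.
Qed.

(** The oscillation is at most 1 on each of the N cells. This serves on the first cell, where 16 N /
    x is not integrable. *)
Lemma defect_sqr_le x : defect x ^+ 2 <= NR ^+ 2.
Proof.
rewrite -real_normK ?num_real// lerXn2r ?nnegrE ?ler0n//.
rewrite (le_trans (defect_le (b := fun=> 1) _))//; last first.
  by rewrite sumr_const_nat subSS subn0.
move=> n y _ _; rewrite (le_trans (ler_normB _ _))//.
by have := kerK_le (n%:R / NR) x; have := kerK_le y x; lra.
Qed.

Lemma defect_norm : dot defect defect <= 32 * (NR * (1 + ln NR)).
Proof.
(* A step majorant of the squared defect: the trivial bound on cell 1, and on cell n > 1 the bound
   16 N / x with x > (n - 1)/N. The values v sum to at most 2 + ln N. *)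
pose v n : R := if (n <= 1)%N then 1 else n.-1%:R^-1.
have v0 n : 0 <= v n by rewrite /v; case: ifP.
have bv : bdmR (fun x => \sum_(1 <= n < N.+1) 16 * NR ^+ 2 * v n * cell n x).
  by apply: bdm_sum => n _; exact: bdmZ.
apply: (@le_trans _ _
  (E (fun x => \sum_(1 <= n < N.+1) 16 * NR ^+ 2 * v n * cell n x))).
  apply: (le_mean mD muD) => // [|x].
    exact: bdmM bdm_defect bdm_defect.
  rewrite /I01/= in_itv/= -expr2 => /andP[].
  rewrite le_eqVlt => /predU1P[<- _|x0 x1].
    rewrite defect0 expr0n/=; apply: sumr_ge0 => n _.
    by rewrite !mulr_ge0// ?sqr_ge0.
  have -> : defect x ^+ 2 = \sum_(1 <= n < N.+1) defect x ^+ 2 * cell n x.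
    by rewrite -mulr_sumr sum_cell// mulr_gt0//= ler_piMr ?mulr1// ltW.
  apply: ler_sum => n _; rewrite /cell.
  case: (boolP (n.-1%:R < NR * x <= n%:R)) => [/andP[h1 h2]|_]; last by rewrite !mulr0.
  rewrite !mulr1 /v; case: leqP => n1.
    rewrite mulr1 (le_trans (defect_sqr_le x))// ler_peMl ?sqr_ge0//; lra.
  apply: (le_trans (defect_sqr _)); first by rewrite x0.
  have n10 : 0 < n.-1%:R :> R by rewrite ltr0n -ltnS prednK// ltnW.
  rewrite -mulrA ler_pM2l ?ltr0n// ler_pdivrMr// mulrAC ler_pdivlMr//.
  by rewrite expr2 -mulrA ler_pM2l// ltW.
rewrite (mean_sum mD muD) => [|n _]; last exact: bdmZ.
have -> : \sum_(1 <= n < N.+1) E (fun x => 16 * NR ^+ 2 * v n * cell n x) =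
    16 * NR * \sum_(1 <= n < N.+1) v n.
  rewrite mulr_sumr; apply: eq_big_seq => n; rewrite mem_index_iota ltnS => nN.
  rewrite (meanZ mD muD)// (mean_cell N0 nN).
  by field; rewrite gt_eqF.
have sv : \sum_(1 <= n < N.+1) v n <= 2 + ln NR.
  rewrite big_ltn// {1}/v/= -[2]/(1 + 1) -addrA lerD2l.
  rewrite big_add1/= big_nat.
  apply: (@le_trans _ _ (\sum_(1 <= k < N.+1) k%:R^-1)); last exact: harmonic_le.
  rewrite [leRHS]big_nat_recr//= big_nat.
  rewrite (eq_bigr (fun n => n%:R^-1)) ?lerDl ?invr_ge0//.
  by move=> n /andP[n1 _]; rewrite /v ltnNge n1.
have l0 : 0 <= ln NR by rewrite ln_ge0// ler1n.
have -> : 32 * (NR * (1 + ln NR)) = 16 * NR * (2 * (1 + ln NR)) by ring.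
by rewrite ler_pM2l ?mulr_gt0//; lra.
Qed.

(** The kernel is smoothed in one variable at a time: the error is the sum of c_m times the defect
    at m/N, plus N <alpha, defect>. *)
Lemma sampled_form_error (delta : R) : 0 < delta ->
  NR * (1 + ln NR) <= delta ^+ 2 * NR ^+ 2 ->
  `|\sum_(1 <= m < N.+1) \sum_(1 <= n < N.+1)
      c m * c n * kerK (m%:R / NR) (n%:R / NR) -
    NR ^+ 2 * dot step (kop step)| <= 26 * delta * NR ^+ 2.
Proof.
move=> d0 dN.
have bH := bdm_defect; have bs := bdm_step; have bF := bdm_sampled.
have bk := bdm_kop_step.
have sumE : \sum_(1 <= m < N.+1) \sum_(1 <= n < N.+1)
      c m * c n * kerK (m%:R / NR) (n%:R / NR) =
    \sum_(1 <= m < N.+1) c m * sampled (m%:R / NR).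
  apply: eq_bigr => m _; rewrite mulr_sumr; apply: eq_bigr => n _.
  by rewrite mulrA kerKC.
have dotF : dot step sampled = \sum_(1 <= m < N.+1) c m * kop step (m%:R / NR).
  rewrite (scal_sumr mD muD)// => [|m _]; last exact: bdmZ.
  apply: eq_bigr => m _; rewrite (scalZr mD muD)//; congr (_ * _).
  exact: scalC.
have dotH : NR * dot step (kop step) = dot step sampled - dot step defect.
  rewrite /scal -(meanZ mD muD); last exact: bdmM.
  rewrite -(meanB mD muD); [|exact: bdmM..].
  by apply: mean_ext => x _; rewrite /defect; ring.
have -> : \sum_(1 <= m < N.+1) \sum_(1 <= n < N.+1)
      c m * c n * kerK (m%:R / NR) (n%:R / NR) - NR ^+ 2 * dot step (kop step) =
    \sum_(1 <= m < N.+1) c m * defect (m%:R / NR) + NR * dot step defect.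
  rewrite sumE expr2 -mulrA dotH mulrBr opprB addrCA addrC; congr (_ + _).
  rewrite dotF mulr_sumr -sumrB; apply: eq_bigr => m _.
  by rewrite /defect; ring.
have di0 : 0 < delta^-1 by rewrite invr_gt0.
have amgm a b : 2 * `|a * b| <= delta * a ^+ 2 + delta^-1 * b ^+ 2.
  have p1 : 0 <= delta^-1 * (delta * a - b) ^+ 2 by rewrite mulr_ge0 ?sqr_ge0// ltW.
  have p2 : 0 <= delta^-1 * (delta * a + b) ^+ 2 by rewrite mulr_ge0 ?sqr_ge0// ltW.
  have q1 : delta^-1 * (delta * a - b) ^+ 2 =
    delta * a ^+ 2 + delta^-1 * b ^+ 2 - 2 * (a * b).
    by field; rewrite gt_eqF.
  have q2 : delta^-1 * (delta * a + b) ^+ 2 =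
    delta * a ^+ 2 + delta^-1 * b ^+ 2 + 2 * (a * b).
    by field; rewrite gt_eqF.
  have -> : 2 * `|a * b| = `|2 * (a * b)| by rewrite [RHS]normrM ger0_norm.
  by rewrite ler_norml; apply/andP; split; lra.
have dNi : delta^-1 * (NR * (1 + ln NR)) <= delta * NR ^+ 2.
  rewrite ler_pdivrMl// mulrA -expr2//.
(* Cauchy-Schwarz with [defect_norm]; 33 = 1 + 32 after the arithmetic-geometric inequality. *)
have dotHle : 2 * `|NR * dot step defect| <= 33 * delta * NR ^+ 2.
  have cs := scal_cauchy_schwarz mD muD bs bH.
  have := amgm NR (dot step defect).
  have : dot step defect ^+ 2 <= 32 * (NR * (1 + ln NR)).
    rewrite (le_trans cs)// -[leRHS]mul1r ler_pM ?scal_ge0// ?step_norm//.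
    exact: defect_norm.
  move/(ler_wpM2l (ltW di0)); rewrite mulrCA; lra.
(* At x = m/N the squared defect is at most 16 N^2 / m, summed by [harmonic_le]; 17 = 1 + 16. *)
have sumH : 2 * `|\sum_(1 <= m < N.+1) c m * defect (m%:R / NR)| <=
    17 * delta * NR ^+ 2.
  apply: (@le_trans _ _ (\sum_(1 <= m < N.+1)
      (delta * NR + 16 * (delta^-1 * NR) * m%:R^-1))).
    rewrite -[2 in leLHS]ger0_norm// -normrM mulr_sumr.
    rewrite (le_trans (ler_norm_sum _ _ _))// big_seq [leRHS]big_seq.
    apply: ler_sum => m; rewrite mem_index_iota ltnS => /andP[m0 mN].
    have m0' : 0 < m%:R :> R by rewrite ltr0n.
    have x01 : 0 < m%:R / NR <= 1 by rewrite divr_gt0//= ler_pdivrMr// mul1r ler_nat.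
    have -> : `|2 * (c m * defect (m%:R / NR))| =
        2 * `|defect (m%:R / NR)| * `|c m|.
      by rewrite !normrM gtr0_norm ?ltr0n//; ring.
    apply: (le_trans (ler_piMr _ (c1 m))); first by rewrite mulr_ge0.
    have := amgm 1 (NR^-1 * defect (m%:R / NR)).
    have -> : 2 * `|1 * (NR^-1 * defect (m%:R / NR))| =
      NR^-1 * (2 * `|defect (m%:R / NR)|).
      by rewrite mul1r normrM gtr0_norm ?invr_gt0// mulrCA.
    rewrite ler_pdivrMl// => /le_trans; apply.
    rewrite expr1n mulr1 mulrDr [NR * delta]mulrC lerD2l.
    have -> : NR * (delta^-1 * (NR^-1 * defect (m%:R / NR)) ^+ 2) =
      delta^-1 * NR^-1 * defect (m%:R / NR) ^+ 2.
      by field; rewrite !gt_eqF.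
    have -> : 16 * (delta^-1 * NR) * m%:R^-1 =
      delta^-1 * NR^-1 * (16 * (NR / (m%:R / NR))).
      by field; rewrite !gt_eqF.
    by rewrite ler_pM2l ?mulr_gt0 ?invr_gt0// defect_sqr.
  rewrite big_split/= sumr_const_nat subSS subn0 -mulr_sumr.
  have h := harmonic_le R N0.
  have p : 0 <= 16 * (delta^-1 * NR) by rewrite !mulr_ge0// ltW.
  have := ler_wpM2l p h; rewrite -mulr_natr.
  move: dNi; rewrite expr2; lra.
(* The two errors add up to (33 + 17)/2 = 25 <= 26. *)
rewrite (le_trans (ler_normD _ _))//.
have p : 0 <= delta * NR ^+ 2 by rewrite mulr_ge0 ?sqr_ge0// ltW.
move: p dotHle sumH; rewrite -!mulrA; lra.
Qed.

End Sampling.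

(** * Eigenfunctions on the unit interval *)

Section Eigenfunctions.
Context {R : realType}.

Local Notation mu := (lebR R).
Local Notation D := (@I01 R).
Local Notation E f := (\int[mu]_(x in D) f x).
Local Notation dot := (scal mu D).
Local Notation bdmR := (@bdm _ (measurableTypeR R) R).
Local Notation kop := (kop mu D kK).

Let mD := @measurable_I01 R.
Let muD := @lebesgue_I01 R.

Lemma bdm_kK : @bdm _ (measurableTypeR R * measurableTypeR R)%type R kK.
Proof. exact: bdm_kerK. Qed.

Lemma kK_sym (x y : R) : kK (x, y) = kK (y, x).
Proof. exact: kerKC. Qed.

Lemma I01E (x : R) : D x = (0 <= x <= 1).
Proof. by rewrite /I01/= in_itv. Qed.

(* An eigenfunction is only constrained on [0, 1]; this is the solution of the
   integral equation on the whole line which extends it. *)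
Definition eigext (l : R) (phi : R -> R) (x : R) : R := l * kop (phi \_ D) x.

(** Square integrability gives integrability on [0, 1], by |phi| <= 1 + |phi|^2; as |K| <= 1/2, the
    integral equation then bounds phi at every point. *)
Lemma eigenfunction_patch_bdm l phi : eigenfunction l phi -> bdmR (phi \_ D).
Proof.
move=> [mphi /andP[_ phi2] phiE].
have mphi' : measurable_fun D (EFin \o phi) by exact/measurable_EFinP.
have fin : (mu D < +oo)%E by rewrite [X in (X < _)%E]muD ltry.
have iphi : mu.-integrable D (EFin \o phi).
  apply: (@le_integrable _ _ _ mu D mD _
    (fun x => (1 + `|phi x| ^+ 2)%:E)) => //.
    move=> x _ /=; rewrite lee_fin [leRHS]ger0_norm ?addr_ge0 ?sqr_ge0//.
    by have := normr_ge0 (phi x); nra.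
  have i1 : mu.-integrable D (EFin \o cst 1).
    exact: (bdm_integrable mD muD (bdm_cst _ 1)).
  have i2 : mu.-integrable D (EFin \o (fun x => `|phi x| ^+ 2)).
    apply/integrableP; split.
      apply/measurable_EFinP; apply: measurable_realfun.measurable_funX.
      exact: measurableT_comp.
    by under eq_integral do rewrite /= ger0_norm ?exprn_ge0//.
  by apply: eq_integrable (integrableD mD i1 i2).
split.
  by apply/(measurable_restrictT phi mD).
exists (`|l| * (2^-1 * E (fun y => `|phi y|))) => x.
have b0 : 0 <= `|l| * (2^-1 * E (fun y => `|phi y|)).
  by rewrite !mulr_ge0 ?invr_ge0//; apply: mean_ge0.
rewrite patchE; case: ifPn => [/set_mem|_]; last by rewrite normr0.
rewrite I01E => x01; rewrite phiE// normrM ler_wpM2l//.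
have mk : measurable_fun D (fun y => kerK x y * phi y).
  apply: measurable_funM => //; apply: measurable_funTS.
  by have [] := bdm_pair1 (T := measurableTypeR R) (U := measurableTypeR R) x bdm_kK.
have kle y : `|kerK x y * phi y| <= 2^-1 * `|phi y|.
  by rewrite normrM ler_wpM2r// kerK_le.
have ihalf : mu.-integrable D (EFin \o (fun y => 2^-1 * `|phi y|)).
  by apply: eq_integrable (integrableZl mD 2^-1 (integrable_norm iphi)).
have ik : mu.-integrable D (EFin \o (fun y => kerK x y * phi y)).
  apply: (le_integrable mD _ _ ihalf); first exact/measurable_EFinP.
  move=> y _ /=; rewrite lee_fin (le_trans (kle y))//.
  by rewrite [leRHS]ger0_norm// mulr_ge0// invr_ge0.
rewrite (le_trans (le_normr_Rintegral mD ik))// -RintegralZl//; last first.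
  exact: integrable_norm.
by apply: le_Rintegral => //; exact: integrable_norm.
Qed.

Lemma eigextP l phi : eigenfunction l phi ->
  [/\ bdmR (eigext l phi), forall x, 0 <= x <= 1 -> eigext l phi x = phi x &
      forall x, eigext l phi x = l * kop (eigext l phi) x].
Proof.
move=> ephi; have bphi := eigenfunction_patch_bdm ephi.
have [_ _ phiE] := ephi.
have ext x : 0 <= x <= 1 -> eigext l phi x = phi x.
  move=> x01; rewrite /eigext [RHS]phiE//; congr (_ * _).
  by apply: mean_ext => y Dy; rewrite patchE mem_set.
split=> // [|x].
  by apply: bdmZ; exact: (kop_bdm mD muD bdm_kK).
rewrite {1}/eigext; congr (_ * _); apply: mean_ext => y Dy.
by rewrite patchE mem_set// ext// -I01E.
Qed.

(** Were the norm 0, Cauchy-Schwarz with the row at x0 would give l g(x0) = 0. *)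
Lemma eigen_norm_gt0 l g x0 : bdmR g -> l != 0 -> g x0 != 0 ->
  (forall x, kop g x = l * g x) -> 0 < dot g g.
Proof.
move=> bg l0 gx0 kg; rewrite lt_neqAle scal_ge0 andbT; apply/eqP => g2.
have := scal_cauchy_schwarz mD muD (bdm_pair1 x0 bdm_kK) bg.
rewrite -g2 mulr0 -[X in X ^+ 2]/(kop g x0) kg => h.
have : (l * g x0) ^+ 2 == 0 by rewrite eq_le h sqr_ge0.
by rewrite sqrf_eq0 mulf_eq0 (negbTE l0) (negbTE gx0).
Qed.

(** The eigenvalues of the kernel are the reciprocals of those of the operator. *)
Lemma bdm_eigenfunction l g x0 : bdmR g -> l != 0 -> g x0 != 0 ->
  (forall x, kop g x = l * g x) -> eigenfunction l^-1 g.
Proof.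
move=> bg l0 gx0 kg; have g2 := eigen_norm_gt0 bg l0 gx0 kg.
split.
- by case: bg => mg _; exact: measurable_funTS.
- have ig : mu.-integrable D (EFin \o (fun x => g x * g x)).
    by apply: (bdm_integrable mD muD); exact: bdmM.
  have -> : (\int[lebesgue_measure]_(x in D) (`|g x| ^+ 2)%:E = (dot g g)%:E)%E.
    rewrite /scal /Rintegral fineK; last exact: integrable_fin_num.
    by apply: eq_integral => x _; rewrite real_normK ?num_real.
  by rewrite lte_fin g2 ltry.
- by move=> x _; apply: (mulfI l0); rewrite mulrA mulfV// mul1r -kg.
Qed.

(** n + 1 functions in a span of n satisfy a nontrivial linear relation; its product with a V i of
    nonzero coefficient leaves only <V i, V i>. *)
Lemma orthogonal_dim n (V : 'I_n.+1 -> R -> R) (e : 'I_n -> R -> R) :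
  (forall i, bdmR (V i)) ->
  (forall i, exists c : 'I_n -> R, forall x, 0 <= x <= 1 ->
     V i x = \sum_(j < n) c j * e j x) ->
  (forall i j, i != j -> dot (V i) (V j) = 0) ->
  exists i, dot (V i) (V i) = 0.
Proof.
move=> bV /choice[c Vc] ortho.
pose C : 'M[R]_(n.+1, n) := \matrix_(i, j) c i j.
have kerC : kermx C != 0.
  by rewrite -mxrank_eq0 mxrank_ker -lt0n subn_gt0 ltnS rank_leq_col.
pose u := nz_row (kermx C).
have u0 : u != 0 by rewrite nz_row_eq0.
have uC : u *m C = 0 by apply/sub_kermxP; exact: nz_row_sub.
have sum0 x : 0 <= x <= 1 -> \sum_i u 0 i * V i x = 0.
  move=> x01; transitivity (\sum_j (u *m C) 0 j * e j x); last first.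
    by rewrite uC big1// => j _; rewrite mxE mul0r.
  transitivity (\sum_i \sum_j u 0 i * c i j * e j x).
    apply: eq_bigr => i _; rewrite Vc// mulr_sumr.
    by apply: eq_bigr => j _; rewrite mulrA.
  rewrite exchange_big; apply: eq_bigr => j _; rewrite !mxE mulr_suml.
  by apply: eq_bigr => i _; rewrite mxE.
have [i ui] : exists i, u 0 i != 0.
  by have /rV0Pn := u0.
exists i; apply: (mulfI ui); rewrite mulr0.
have <- : dot (V i) (fun x => \sum_k u 0 k * V k x) = 0.
  rewrite -[RHS](mean_cst mD muD (0 : R)); apply: mean_ext => x.
  by rewrite I01E => x01; rewrite sum0// mulr0.
rewrite (scal_sumr mD muD)// => [|k _]; last exact: bdmZ.
rewrite (bigD1 i)//= (scalZr mD muD)// big1 ?addr0// => k ki.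
by rewrite (scalZr mD muD)// ortho ?mulr0// eq_sym.
Qed.

End Eigenfunctions.

(** * The listed eigenfunctions *)

Section Spectrum.
Context {R : realType}.
Variables (p q : option nat) (lamp lamm : nat -> R) (phip phim : nat -> R -> R).
Hypotheses (Lp : lists_positive_eigenvalues p lamp)
  (Lm : lists_negative_eigenvalues q lamm)
  (Ep : eigenfunctions_of p lamp phip) (Em : eigenfunctions_of q lamm phim)
  (Opm : orthonormal2 p q phip phim).

Local Notation mu := (lebR R).
Local Notation D := (@I01 R).
Local Notation dot := (scal mu D).
Local Notation bdmR := (@bdm _ (measurableTypeR R) R).
Local Notation kop := (kop mu D kK).

Let mD := @measurable_I01 R.
Let muD := @lebesgue_I01 R.

(* Both families at once: [(true, k)] is the index of the [k]-th positive
   eigenvalue and [(false, k)] that of the [k]-th negative one. *)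
Definition spec_range (i : bool * nat) := in_range (if i.1 then p else q) i.2.
Definition spec_lam (i : bool * nat) := (if i.1 then lamp else lamm) i.2.
Definition spec_phi (i : bool * nat) := (if i.1 then phip else phim) i.2.
Definition spec_ext i := eigext (spec_lam i) (spec_phi i).

Lemma spec_eigenfunction i : spec_range i ->
  eigenfunction (spec_lam i) (spec_phi i).
Proof. by case: i => -[] k; [move=> /Ep[]|move=> /Em[]]. Qed.

Lemma spec_lam_neq0 i : spec_range i -> spec_lam i != 0.
Proof.
case: i => -[] k ik; rewrite /spec_lam/=.
  by case: Lp => /(_ k ik)[l0 _] _ _; rewrite gt_eqF.
by case: Lm => /(_ k ik)[l0 _] _ _; rewrite lt_eqF.
Qed.

Lemma spec_ext_bdm i : spec_range i -> bdmR (spec_ext i).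
Proof. by move=> /spec_eigenfunction/eigextP[]. Qed.

Lemma spec_extE i x : spec_range i -> 0 <= x <= 1 -> spec_ext i x = spec_phi i x.
Proof. by move=> /spec_eigenfunction/eigextP[_ + _]; apply. Qed.

Lemma spec_ext_eigen i x : spec_range i ->
  kop (spec_ext i) x = (spec_lam i)^-1 * spec_ext i x.
Proof.
move=> ir; have [_ _ h] := eigextP (spec_eigenfunction ir).
by rewrite [in RHS]/spec_ext h mulrA mulVf ?mul1r// spec_lam_neq0.
Qed.

Lemma spec_ext_ortho i j : spec_range i -> spec_range j ->
  dot (spec_ext i) (spec_ext j) = (i == j)%:R.
Proof.
move=> ir jr; have -> : dot (spec_ext i) (spec_ext j) = inner (spec_phi i) (spec_phi j).
  by apply: mean_ext => x; rewrite I01E => x01; rewrite !spec_extE.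
have [Op Om Oc] := Opm.
case: i j ir jr => -[] k [[] m] ir jr; rewrite /spec_phi/=.
- by rewrite Op.
- by rewrite Oc.
- by rewrite -[RHS](Oc m k jr ir); apply: mean_ext => x _; rewrite mulrC.
- by rewrite Om.
Qed.

(** The lists contain [l^-1] exactly as often as its index n. The n listed eigenfunctions together
    with g would be n + 1 pairwise orthogonal nonzero functions in a space of dimension n. *)
Lemma spec_complete l g : l != 0 -> bdmR g -> (forall x, kop g x = l * g x) ->
  (forall i, spec_range i -> spec_lam i = l^-1 -> dot g (spec_ext i) = 0) ->
  forall x, g x = 0.
Proof.
move=> l0 bg kg gperp x0; apply/eqP/negPn/negP => gx0.
have eg := bdm_eigenfunction bg l0 gx0 kg.
have g2 := eigen_norm_gt0 bg l0 gx0 kg.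
pose s := 0 < l.
have [n [e [_ _ espan]] card] : exists2 n, has_index l^-1 n &
    ([set k | spec_range (s, k) /\ spec_lam (s, k) = l^-1] #= `I_n)%card.
  rewrite /s; have [lpos|lneg] := ltP 0 l.
    by case: Lp => _ _ /(_ l^-1); rewrite invr_gt0 => /(_ lpos).
  case: Lm => _ _ /(_ l^-1); rewrite invr_lt0 lt_neqAle l0 lneg.
  by move=> /(_ isT).
set A := [set k | _] in card.
have finA : finite_set A by exists n.
pose t := finmap.enum_fset (fset_set A).
have st : size t = n by have := card_fset_set card.
have tA k : k \in t -> A k by rewrite in_fset_set// => /set_mem.
(* The listed eigenfunctions occupy the places below n, and g takes the last one. *)
pose V (i : 'I_n.+1) := if (i < n)%N then spec_ext (s, nth 0%N t i) else g.
have Vt (i : 'I_n.+1) : (i < n)%N -> A (nth 0%N t i).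
  by move=> ni; apply: tA; rewrite mem_nth// st.
have [i Vi] : exists i, dot (V i) (V i) = 0.
  apply: (@orthogonal_dim _ _ V e) => [i|i|i j ij].
  - rewrite /V; case: ifP => // /Vt[ir _]; exact: spec_ext_bdm.
  - rewrite /V; case: ifP => [/Vt[ir il]|_]; last exact: espan.
    have [c cE] := espan _
      (eq_ind _ (fun z => eigenfunction z _) (spec_eigenfunction ir) _ il).
    by exists c => x x01; rewrite spec_extE// cE.
  - rewrite /V; case: ifPn => ni; case: ifPn => nj.
    + have [ir _] := Vt i ni; have [jr _] := Vt j nj.
      rewrite spec_ext_ortho// xpair_eqE eqxx/= nth_uniq ?st//; last first.
        exact: finmap.fset_uniq.
      by rewrite (negbTE ij : (i == j :> nat) = false).
    + by have [ir il] := Vt i ni; rewrite scalC; exact: gperp.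
    + by have [jr jl] := Vt j nj; exact: gperp.
    + case/negP: ij; apply/eqP/val_inj.
      have := ltn_ord i; have := ltn_ord j; rewrite !ltnS /= => jn in'.
      have /eqP -> : (i == n :> nat) by rewrite eqn_leq in' leqNgt.
      by apply/eqP; rewrite eq_sym eqn_leq jn leqNgt.
move: Vi; rewrite /V; case: ifP => [/Vt[ir _]|_].
  by rewrite spec_ext_ortho// eqxx => /eqP; rewrite oner_eq0.
by move/eqP; rewrite gt_eqF.
Qed.

(** The squares of the nu_i sum to at most 1/4, the square of the bound 1/2 of the kernel. *)
Lemma spec_size_le (delta : R) r : 0 < delta -> uniq r ->
  (forall i, i \in r -> spec_range i /\ delta < `|(spec_lam i)^-1|) ->
  (size r)%:R * delta ^+ 2 <= 4^-1.
Proof.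
move=> d0 ur rP.
have rr i : i \in r -> spec_range i by move=> /rP[].
have := sum_sqr_eigenvalues mD muD bdm_kK ur (nu := fun i => (spec_lam i)^-1)
  (fun i ir => spec_ext_bdm (rr i ir))
  (fun i j ir jr => spec_ext_ortho (rr i ir) (rr j jr))
  (fun i ir x => spec_ext_eigen x (rr i ir)) (B := 2^-1) (fun z => kerK_le z.1 z.2).
have -> : 2^-1 ^+ 2 = 4^-1 :> R by field.
apply: le_trans; rewrite mulr_natl.
have -> : delta ^+ 2 *+ size r = \sum_(i <- r) delta ^+ 2.
  by rewrite big_const_seq count_predT iter_addr_0.
rewrite big_seq [leRHS]big_seq; apply: ler_sum => i /rP[_ di].
by rewrite -[leRHS]real_normK ?num_real// lerXn2r ?nnegrE// ltW.
Qed.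

Definition spec_above (delta : R) (s : bool) :=
  [set k | spec_range (s, k) /\ delta < `|(spec_lam (s, k))^-1|].

(** At most 1/(4 delta^2) indices qualify, so the sums over j are genuine finite sums. *)
Lemma finite_spec_above delta s : 0 < delta -> finite_set (spec_above delta s).
Proof.
move=> d0; apply: contrapT => infA.
pose n := (Num.truncn (4^-1 / delta ^+ 2)).+1.
have [B BA nB] := infinite_set_fset n infA.
pose r := [seq (s, k) | k <- finmap.enum_fset B].
have ur : uniq r.
  by rewrite map_inj_uniq ?finmap.fset_uniq// => a b [].
have rP i : i \in r -> spec_range i /\ delta < `|(spec_lam i)^-1|.
  by move=> /mapP[k kB ->]; apply: BA.
have := spec_size_le d0 ur rP; rewrite size_map -ler_pdivlMr ?exprn_gt0//.
by rewrite leNgt (lt_le_trans (truncnS_gt _))// ler_nat; exact: nB.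
Qed.

(* 92 = 26 + 65 + 1: sampling of the kernel, sampling of the eigenfunctions,
   quadratic form of the deflated operator. *)
Lemma sampled_spectral_form N (c : nat -> R) (delta : R) (S : bool * nat -> R) :
  (0 < N)%N -> (forall n, `|c n| <= 1) -> 0 < delta ->
  N%:R * (1 + ln N%:R) <= delta ^+ 2 * N%:R ^+ 2 ->
  (forall i, S i = \sum_(1 <= n < N.+1) c n * spec_phi i (n%:R / N%:R)) ->
  `|\sum_(1 <= m < N.+1) \sum_(1 <= n < N.+1)
      c m * c n * kerK (m%:R / N%:R) (n%:R / N%:R) -
    (\sum_(k \in spec_above delta true) (lamp k)^-1 * S (true, k) ^+ 2 +
     \sum_(k \in spec_above delta false) (lamm k)^-1 * S (false, k) ^+ 2)|
  <= 92 * delta * N%:R ^+ 2.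
Proof.
move=> N0 c1 d0 dN SE.
have fA s := finite_spec_above s d0.
pose t s := finmap.enum_fset (fset_set (spec_above delta s)).
have tA s k : k \in t s -> spec_above delta s k.
  by rewrite in_fset_set// => /set_mem.
pose r := [seq (true, k) | k <- t true] ++ [seq (false, k) | k <- t false].
have ur : uniq r.
  rewrite cat_uniq !map_inj_uniq ?finmap.fset_uniq ?andbT//=; [|by move=> a b []..].
  by apply/hasPn => _ /mapP[k _ ->]; apply/mapP => -[].
have rP i : i \in r -> spec_range i /\ delta < `|(spec_lam i)^-1|.
  by rewrite mem_cat => /orP[] /mapP[k /tA ? ->].
have rr i : i \in r -> spec_range i by move=> /rP[].
pose nuv i := (spec_lam i)^-1.
have -> : \sum_(k \in spec_above delta true) (lamp k)^-1 * S (true, k) ^+ 2 +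
    \sum_(k \in spec_above delta false) (lamm k)^-1 * S (false, k) ^+ 2 =
    \sum_(i <- r) nuv i * S i ^+ 2.
  by rewrite !fsbig_finite// big_cat !big_map.
have bext i (ir : i \in r) := spec_ext_bdm (rr i ir).
have oext i j (ir : i \in r) (jr : j \in r) := spec_ext_ortho (rr i ir) (rr j jr).
have eext i (ir : i \in r) x := spec_ext_eigen x (rr i ir).
pose alpha := step N c.
have balpha := bdm_step N0 c : bdmR alpha.
have alpha1 := step_norm N0 c1 : dot alpha alpha <= 1.
have e1 := sampled_form_error N0 c1 d0 dN.
have bF := bdm_sampled N c : bdmR (sampled N c).
have bker x : bdmR (kerK x) by exact: (bdm_pair1 x bdm_kK).
(* The eigenvalue equation at the grid point n/N turns <K(n/N, .), phi_i> into nu_i phi_i(n/N). *)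
have sF i : i \in r -> nuv i * S i = dot (sampled N c) (spec_ext i).
  move=> ir; rewrite scalC (scal_sumr mD muD); last 2 first.
  - exact: bext.
  - by move=> n _; apply: bdmZ; exact: bker.
  rewrite SE mulr_sumr; apply: eq_big_seq => n.
  rewrite mem_index_iota ltnS => /andP[n0 nN].
  have n01 : 0 <= (n%:R / N%:R : R) <= 1.
    by rewrite divr_ge0//= ler_pdivrMr ?ltr0n// mul1r ler_nat.
  rewrite (scalZr mD muD); [|exact: bext|exact: bker].
  rewrite mulrCA; congr (_ * _).
  by rewrite -spec_extE ?rr// -spec_ext_eigen ?rr// scalC.
have e2 := sampled_form_le mD muD bdm_kK kK_sym ur bext oext eext balpha bF
  alpha1 d0 (fun i ir => proj2 (rP i ir)) sF
  (fun x => erefl : defect N c x = sampled N c x - N%:R * kop alpha x).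
have complete l g : delta < `|l| -> bdmR g -> (forall x, kop g x = l * g x) ->
    (forall i, i \in r -> dot g (spec_ext i) = 0) -> forall x, g x = 0.
  move=> dl bg kg gr; have l0 : l != 0 by rewrite -normr_gt0 (lt_trans d0).
  apply: spec_complete l0 bg kg _ => -[s k] ir il; apply: gr.
  have kt : k \in t s.
    by rewrite in_fset_set// mem_set//; split=> //; rewrite il invrK.
  rewrite mem_cat; apply/orP; case: s kt ir il => kt _ _.
    by left; apply/mapP; exists k.
  by right; apply/mapP; exists k.
have e3 := deflated_form_le mD muD bdm_kK kK_sym ur bext oext eext balpha (ltW d0)
  complete.
have NR0 : 0 < N%:R :> R by rewrite ltr0n.
pose T := \sum_(i <- r) nuv i * dot alpha (spec_ext i) ^+ 2.
have AE : \sum_(i <- r) nuv i * (N%:R * dot alpha (spec_ext i)) ^+ 2 = N%:R ^+ 2 * T.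
  by rewrite /T mulr_sumr; apply: eq_bigr => i _; ring.
(* 64 is twice the 32 of [defect_norm]. *)
have W : 2 * dot (defect N c) (defect N c) / delta <= 64 * delta * N%:R ^+ 2.
  have h := le_trans (defect_norm N0 c1) (ler_wpM2l (ler0n _ 32) dN).
  rewrite ler_pdivrMr//; have -> : 64 * delta * N%:R ^+ 2 * delta =
    2 * (32 * (delta ^+ 2 * N%:R ^+ 2)) by ring.
  by rewrite ler_pM2l.
rewrite AE in e2.
have e3' : `|N%:R ^+ 2 * dot alpha (kop alpha) - N%:R ^+ 2 * T| <= delta * N%:R ^+ 2.
  rewrite -mulrBr normrM ger0_norm ?exprn_ge0// mulrC ler_pM2r ?exprn_gt0//.
  by rewrite (le_trans e3)// ler_piMr// ltW.
have e2' := le_trans e2 (lerD W (lexx _)).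
move: e1 e2' e3'; rewrite -/alpha -!mulrA.
set X := N%:R ^+ 2 * dot alpha (kop alpha); set Y := N%:R ^+ 2 * T.
set Q := \sum_(1 <= m < N.+1) _; set Z := \sum_(i <- r) _.
set Dl := delta * _; rewrite !ler_norml => /andP[? ?] /andP[? ?] /andP[? ?].
by apply/andP; split; lra.
Qed.

End Spectrum.

(** * The sum of the Moebius function up to a square *)

Lemma frac_ratio (R : realType) (a b : nat) : (0 < b)%N ->
  Defs.frac (a%:R / b%:R : R) = a%:R / b%:R - (a %/ b)%:R.
Proof.
move=> b0; rewrite /Defs.frac (@floor_def _ _ (a %/ b)%:Z)// intrD1 -pmulrn.
rewrite ler_pdivlMr ?ltr0n// ltr_pdivrMr ?ltr0n// natr1 -!natrM ler_nat ltr_nat.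
by rewrite leq_divM -ltn_divLR// ltnS leqnn.
Qed.

(** At the grid points 1/(xy) is N^2/(mn), so the kernel records the fractional part lost in the
    integer quotient. *)
Lemma kerK_grid (R : realType) (N m n : nat) : (0 < N)%N -> (0 < m)%N -> (0 < n)%N ->
  (N ^ 2 %/ (m * n))%:R = N%:R ^+ 2 / (m%:R * n%:R) - 2^-1 +
    kerK (m%:R / N%:R) (n%:R / N%:R) :> R.
Proof.
move=> N0 m0 n0; rewrite kerK_gt0 ?divr_gt0 ?ltr0n//.
have -> : (m%:R / N%:R * (n%:R / N%:R))^-1 = (N ^ 2)%:R / (m * n)%:R :> R.
  by rewrite natrX natrM; field; rewrite !pnatr_eq0 -!lt0n m0 n0 N0.
by rewrite frac_ratio ?muln_gt0 ?m0// natrX natrM; ring.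
Qed.

Lemma norm_mobius_le1 (R : realType) n : `|(mobius n)%:~R| <= 1 :> R.
Proof.
rewrite /mobius; case: ifP => _; last by rewrite normr0.
by rewrite rmorphXn/= rmorphN1 normrX normrN1 expr1n.
Qed.

Lemma mertensE (R : realType) n : mertens (n%:R : R) = \sum_(1 <= k < n.+1) mobius k.
Proof.
rewrite /mertens (_ : Num.truncn (n%:R : R) = n)//; apply: truncn_def.
by rewrite lexx ltr_nat ltnS leqnn.
Qed.

(** [kerK_grid] inserted in [meissel_identity]: the main term N^2/(mn) gives the square of the sum
    of mu(n)/n, the constant 1/2 gives M(N)^2/2, and the kernel gives Q. *)
Lemma mertens_square (R : realType) (N : nat) (Q : R) : (0 < N)%N ->
  Q = \sum_(1 <= m < N.+1) \sum_(1 <= n < N.+1)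
    (mobius m)%:~R * (mobius n)%:~R * kerK (m%:R / N%:R) (n%:R / N%:R) ->
  (mertens (N%:R ^+ 2 : R))%:~R = 2 * (mertens (N%:R : R))%:~R
    + (mertens (N%:R : R))%:~R ^+ 2 / 2
    - (\sum_(1 <= n < N.+1) (mobius n)%:~R / n%:R) ^+ 2 * N%:R ^+ 2 - Q.
Proof.
move=> N0 QE; rewrite -natrX !mertensE meissel_identity// rmorphB rmorphM/=.
set M := (\sum_(1 <= n < N.+1) mobius n)%:~R : R.
have ME : M = \sum_(1 <= n < N.+1) (mobius n)%:~R by rewrite /M rmorph_sum.
set B := \sum_(1 <= n < N.+1) (mobius n)%:~R / n%:R : R.
have -> : (\sum_(1 <= m < N.+1) \sum_(1 <= n < N.+1)
    mobius m * mobius n * (N ^ 2 %/ (m * n))%:Z)%:~R =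
    N%:R ^+ 2 * B ^+ 2 - 2^-1 * M ^+ 2 + Q :> R; last first.
  by rewrite -!addrA; congr (_ + _); lra.
have sq (f : nat -> R) : (\sum_(1 <= n < N.+1) f n) ^+ 2 =
    \sum_(1 <= m < N.+1) \sum_(1 <= n < N.+1) f m * f n.
  by rewrite expr2 mulr_suml; apply: eq_bigr => m _; rewrite mulr_sumr.
rewrite ME /B !sq QE !mulr_sumr -sumrB -big_split/= rmorph_sum/=.
apply: eq_big_nat => m /andP[m0 _].
rewrite !mulr_sumr -sumrB -big_split/= rmorph_sum/=.
apply: eq_big_nat => n /andP[n0 _].
rewrite !rmorphM/= -pmulrn kerK_grid//.
by field; rewrite !pnatr_eq0 -!lt0n m0 n0.
Qed.

Theorem theorem3 (R : realType) :
  exists C : R, 0 < C /\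
    forall (p q : option nat) (lamp lamm : nat -> R)
           (phip phim : nat -> R -> R),
      lists_positive_eigenvalues p lamp ->
      lists_negative_eigenvalues q lamm ->
      eigenfunctions_of p lamp phip ->
      eigenfunctions_of q lamm phim ->
      orthonormal2 p q phip phim ->
      forall (N : nat) (delta : R),
        (0 < N)%N ->
        Num.sqrt ((1 + ln N%:R) / N%:R) < delta ->
        exists E : R,
          (mertens (N%:R ^+ 2 : R))%:~R =
            \sum_(j \in [set j | `|nu q lamm j| > delta])
              ((\sum_(1 <= n < N.+1)
                  (mobius n)%:~R * phim j (n%:R / N%:R)) ^+ 2
               * `|nu q lamm j|)
            - \sum_(j \in [set j | nu p lamp j > delta])
              ((\sum_(1 <= n < N.+1)
                  (mobius n)%:~R * phip j (n%:R / N%:R)) ^+ 2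
               * nu p lamp j)
            + ((mertens (N%:R : R))%:~R) ^+ 2 / 2
            - (\sum_(1 <= n < N.+1) (mobius n)%:~R / n%:R) ^+ 2 * N%:R ^+ 2
            + E
          /\ `|E| <= C * delta * N%:R ^+ 2.
Proof.
(* 94 = 92 + 2: the spectral approximation of Q, and the term 2 M(N). *)
exists 94; split; first by rewrite ltr0n.
move=> p q lamp lamm phip phim Lp Lm Ep Em Opm N delta N0 sdelta.
have d0 : 0 < delta by exact: le_lt_trans (sqrtr_ge0 _) sdelta.
have NR0 : 0 < N%:R :> R by rewrite ltr0n.
have NR1 : 1 <= N%:R :> R by rewrite ler1n.
have l0 : 0 <= ln (N%:R : R) by exact: ln_ge0.
have dN : N%:R * (1 + ln N%:R) <= delta ^+ 2 * N%:R ^+ 2.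
  have q0 : 0 <= (1 + ln N%:R) / N%:R :> R by rewrite divr_ge0 ?addr_ge0// ltW.
  have : (1 + ln N%:R) / N%:R <= delta ^+ 2 :> R.
    by rewrite -[leLHS]sqr_sqrtr// lerXn2r ?nnegrE ?sqrtr_ge0// ltW.
  rewrite ler_pdivrMr// => h.
  by rewrite mulrC expr2 mulrA ler_pM2r.
pose S i := \sum_(1 <= n < N.+1) (mobius n)%:~R * spec_phi phip phim i (n%:R / N%:R).
have := sampled_spectral_form Lp Lm Ep Em Opm N0 (norm_mobius_le1 R) d0 dN
  (fun i => erefl (S i)).
set Q := \sum_(1 <= m < N.+1) _.
have -> : \sum_(k \in spec_above p q lamp lamm delta true)
      (lamp k)^-1 * S (true, k) ^+ 2 =
    \sum_(j \in [set j | nu p lamp j > delta])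
      ((\sum_(1 <= n < N.+1) (mobius n)%:~R * phip j (n%:R / N%:R)) ^+ 2
       * nu p lamp j).
  (* [nu] is 0 outside the range, so exceeding delta > 0 already places j in the list. *)
  have -> : spec_above p q lamp lamm delta true = [set j | nu p lamp j > delta].
    apply/seteqP; split=> j; rewrite /spec_above /spec_range /spec_lam /nu/=.
      move=> [jr]; rewrite jr gtr0_norm// invr_gt0.
      by case: Lp => /(_ j jr)[].
    case: ifP => [jr dj|_ dlt]; last by have := lt_trans d0 dlt; rewrite ltxx.
    by split=> //; rewrite gtr0_norm// (lt_trans d0).
  apply: eq_fsbigr => j /set_mem/=; rewrite /nu mulrC.
  by case: ifP => // _ dlt; have := lt_trans d0 dlt; rewrite ltxx.
(* For the negative eigenvalues nu = -|nu|, whence the opposite sign of their sum. *)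
have -> : \sum_(k \in spec_above p q lamp lamm delta false)
      (lamm k)^-1 * S (false, k) ^+ 2 =
    - \sum_(j \in [set j | `|nu q lamm j| > delta])
      ((\sum_(1 <= n < N.+1) (mobius n)%:~R * phim j (n%:R / N%:R)) ^+ 2
       * `|nu q lamm j|).
  have fA := finite_spec_above Lp Lm Ep Em Opm false d0.
  have AE : spec_above p q lamp lamm delta false = [set j | `|nu q lamm j| > delta].
    apply/seteqP; split=> j; rewrite /spec_above /spec_range /spec_lam /nu/=.
      by move=> [->].
    case: ifP => // _; rewrite normr0 => dlt.
    by have := lt_trans d0 dlt; rewrite ltxx.
  rewrite -AE !fsbig_finite// -sumrN; apply: eq_big_seq => j.
  rewrite in_fset_set// => /set_mem[jr _].
  have jq : in_range q j by [].
  have lj : lamm j < 0 by case: Lm => /(_ j jq)[].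
  by rewrite /nu jq ltr0_norm ?invr_lt0// mulrN opprK mulrC.
set Sp := \sum_(j \in _) _; set Sm := \sum_(j \in _) _ => QS.
set M : R := (mertens (N%:R : R))%:~R; set B := (\sum_(1 <= n < N.+1) _ / _) ^+ 2 * _.
have M2 := mertens_square N0 (erefl Q).
have MN : `|M| <= N%:R.
  rewrite /M mertensE rmorph_sum/= (le_trans (ler_norm_sum _ _ _))//.
  rewrite (le_trans (ler_sum _ (fun n _ => norm_mobius_le1 R n)))//.
  by rewrite sumr_const_nat subSS subn0.
(* The lower bound on delta forces delta N >= 1, which lets the error absorb |M(N)| <= N. *)
have Ndelta : N%:R <= delta * N%:R ^+ 2.
  have t0 : 0 <= delta * N%:R by rewrite mulr_ge0// ltW.
  have t2 : 1 <= (delta * N%:R) ^+ 2.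
    rewrite exprMn (le_trans _ dN)// mulr_ege1// lerDl//.
  have t1 : 1 <= delta * N%:R by nra.
  by rewrite expr2 mulrA ler_peMl// ltW.
exists (2 * M - (Q - (Sp + - Sm))); split.
  by rewrite M2 -/M -/B; ring.
rewrite (le_trans (ler_normB _ _))// normrM (ger0_norm (ler0n _ _)).
move: QS; rewrite -!mulrA => QS; lra.
Qed.
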